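(* Let $\mathcal{C}$ be an effectively compact and effectively orthogonal class of probability measures on $\Omega=\{0,1\}^{\mathbb{N}}$. Then for every $P\in\mathcal{C}$ and every $\omega\in\Omega$, $\omega$ is uniformly random with respect to $P$ if and only if $\omega$ is blindly random with respect to $P$.
   Context: $\mathcal{M}(\Omega)$ is the space of probability measures on $\Omega$ with basic sets given by finitely many conditions $u<Q(y)<v$ ($y$ a word, $u,v$ rational, $Q(y)=Q(y\Omega)$). $\mathcal{C}$ is effectively compact if compact and the finite families of basic sets covering it form an enumerable set. Lower semicomputable functions on $\Omega$ (resp. $\Omega\times\mathcal{M}(\Omega)$): each superlevel set $\{f>r\}$, $r$ rational, is a union of an enumerable family of intervals $x\Omega$ (resp. products $x\Omega\times\beta$), uniformly in $r$. A uniform test is a lower semicomputable $t(\omega,Q)\ge0$ with $\int t(\omega,Q)\,dQ(\omega)\le1$ for all $Q$; with $\mathbf{t}$ universal (maximal up to a constant factor), $\omega$ is uniformly random w.r.t. $Q$ if $\mathbf{t}(\omega,Q)<\infty$; $\mathrm{Randoms}(Q)$ is the set of such $\omega$. $\mathcal{C}$ is effectively orthogonal if $\mathrm{Randoms}(P)\cap\mathrm{Randoms}(Q)=\varnothing$ for all distinct $P,Q\in\mathcal{C}$. $\omega$ is blindly random w.r.t. $P$ if $t(\omega)<\infty$ for every lower semicomputable $t:\Omega\to[0,\infty]$ with $\int t\,dP\le1$. *)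

(* Defs.v *)
From HB Require Import structures.
From Stdlib.Arith Require Cantor.
From mathcomp Require Import all_boot all_order all_algebra.
From mathcomp Require Import all_classical all_reals all_analysis.

Set Implicit Arguments.
Unset Strict Implicit.
Unset Printing Implicit Defensive.

Import Order.TTheory GRing.Theory Num.Theory.

Local Open Scope classical_set_scope.
Local Open Scope ring_scope.

(* Partial recursive functions nat -> nat; several arguments are passed through
   the Cantor bijection, whose projections are taken as primitive (they are
   primitive recursive, so the class of functions is the usual one). *)
Inductive code : Type :=
| Zero | Succ | Left | Right
| Pair of code & code
| Comp of code & code
| Prec of code & code
| Mu of code.

Definition pairn (a b : nat) : nat := Cantor.to_nat (a, b).

(* [computes c n m]: the function with code [c] is defined at [n], with value
   [m].  [Prec f g] sends <a, k> to the k-th term of the sequence s 0 = f(a),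
   s (i+1) = g<a, <i, s i>>; [Mu f] sends n to the least m with f<n, m> = 0,
   all the values f<n, j> for j < m being defined. *)
Fixpoint computes (c : code) (n m : nat) {struct c} : Prop :=
  match c with
  | Zero => m = 0%N
  | Succ => m = n.+1
  | Left => m = (Cantor.of_nat n).1
  | Right => m = (Cantor.of_nat n).2
  | Pair f g => exists a b, [/\ computes f n a, computes g n b & m = pairn a b]
  | Comp f g => exists2 k, computes g n k & computes f k m
  | Prec f g =>
      let a := (Cantor.of_nat n).1 in
      let k := (Cantor.of_nat n).2 in
      exists s : nat -> nat,
        [/\ computes f a (s 0%N),
            forall i, (i < k)%N -> computes g (pairn a (pairn i (s i))) (s i.+1)
          & m = s k]
  | Mu f => computes f (pairn n m) 0%N /\
      forall j, (j < m)%N -> exists k, computes f (pairn n j) k.+1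
  end.

(* [S] is the set of the objects listed by some algorithm, [e] being an
   (injective) coding of the objects by natural numbers. *)
Definition enumerable {T : Type} (e : T -> nat) (S : set T) : Prop :=
  exists c : code, forall m : nat,
    (exists n, computes c n m) <-> (exists2 x, S x & e x = m).

Definition enc_prod {T U : Type} (e : T -> nat) (f : U -> nat) (p : T * U) :
  nat := pairn (e p.1) (f p.2).

Definition enc_seq {T : Type} (e : T -> nat) (s : seq T) : nat :=
  foldr (fun x n => (pairn (e x) n).+1) 0%N s.

Definition enc_int (z : int) : nat :=
  match z with Posz n => n.*2 | Negz n => n.*2.+1 end.

Definition enc_rat (q : rat) : nat := pairn (enc_int (numq q)) `|denq q|%N.

Definition word := seq bool.

Definition enc_word : word -> nat := enc_seq nat_of_bool.

Definition cylinder (y : word) : set (nat -> bool) :=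
  [set w | forall i, (i < size y)%N -> w i = nth false y i].

Definition Omega := g_sigma_algebraType (range cylinder).

HB.instance Definition _ := Measurable.on Omega.

(* Alias of the library type of probability measures, carrying the topology
   whose base is the family of basic sets. *)
Definition measures (R : realType) : Type := probability Omega R.

HB.instance Definition _ (R : realType) := Pointed.on (measures R).

(* A finite list of conditions u < Q(y) < v. *)
Definition basic := seq (word * rat * rat).

Definition enc_basic : basic -> nat :=
  enc_seq (enc_prod (enc_prod enc_word enc_rat) enc_rat).

Definition basic_set (R : realType) (b : basic) : set (measures R) :=
  [set Q | forall y u v, (y, u, v) \in b ->
    ((ratr u)%:E < Q (cylinder y) /\ Q (cylinder y) < (ratr v)%:E)%E].
Arguments basic_set : clear implicits.

Section MeasuresTopology.
Variable R : realType.

Let basic_set_cover : \bigcup_(B in range (basic_set R)) B = setT.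
Proof.
rewrite -subTset => Q _; exists (basic_set R [::]); last by move=> ? ? ?.
by exists [::].
Qed.

Let basic_set_join (A B : set (measures R)) Q :
  range (basic_set R) A -> range (basic_set R) B -> A Q -> B Q ->
  exists k, [/\ range (basic_set R) k, k Q & k `<=` A `&` B].
Proof.
move=> [a _ <-] [b _ <-] aQ bQ; exists (basic_set R (a ++ b)); split.
- by exists (a ++ b).
- by move=> y u v; rewrite mem_cat => /orP[/aQ|/bQ].
- by move=> Q' abQ'; split=> y u v yuv; apply: abQ';
    rewrite mem_cat yuv ?orbT.
Qed.

HB.instance Definition _ := @isBaseTopological.Build (measures R)
  (set (measures R)) (range (basic_set R)) id basic_set_cover basic_set_join.

End MeasuresTopology.

Definition effectively_compact (R : realType) (C : set (measures R)) : Prop :=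
  compact C /\
  enumerable (enc_seq enc_basic)
    [set s : seq basic | C `<=` \bigcup_(b in [set` s]) basic_set R b].

(* Enumerability of the set of pairs (r, x), resp. triples (r, x, b), is
   uniformity in r. *)
Definition lower_semicomputable (R : realType) (t : Omega -> \bar R) : Prop :=
  exists2 E : set (rat * word), enumerable (enc_prod enc_rat enc_word) E &
    forall r : rat, [set w | ((ratr r)%:E < t w)%E] =
      \bigcup_(x in [set x | E (r, x)]) cylinder x.

Definition lower_semicomputable2 (R : realType)
    (t : Omega -> measures R -> \bar R) : Prop :=
  exists2 E : set (rat * word * basic),
    enumerable (enc_prod (enc_prod enc_rat enc_word) enc_basic) E &
    forall r : rat, [set wQ | ((ratr r)%:E < t wQ.1 wQ.2)%E] =
      \bigcup_(xb in [set xb | E (r, xb.1, xb.2)])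
        (cylinder xb.1 `*` basic_set R xb.2).

Definition uniform_test (R : realType)
    (t : Omega -> measures R -> \bar R) : Prop :=
  [/\ lower_semicomputable2 t,
      forall w Q, (0 <= t w Q)%E
    & forall Q : measures R, (\int[Q]_w t w Q <= 1)%E].

Definition universal_uniform_test (R : realType)
    (t : Omega -> measures R -> \bar R) : Prop :=
  uniform_test t /\
  forall t', uniform_test t' ->
    exists2 c : R, 0 < c & forall w Q, (t' w Q <= c%:E * t w Q)%E.

(* In the next three definitions [t] stands for a universal uniform test; the
   notions do not depend on which one. *)
Definition uniformly_random (R : realType) (t : Omega -> measures R -> \bar R)
    (Q : measures R) (w : Omega) : Prop := (t w Q < +oo)%E.

Definition Randoms (R : realType) (t : Omega -> measures R -> \bar R)
    (Q : measures R) : set Omega := [set w | uniformly_random t Q w].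

(* A library measure is a function on all sets, unconstrained outside the
   sigma-algebra: distinct measures are those that differ on a measurable set. *)
Definition effectively_orthogonal (R : realType)
    (t : Omega -> measures R -> \bar R) (C : set (measures R)) : Prop :=
  forall P Q : measures R, C P -> C Q ->
    (exists2 A : set Omega, measurable A & P A <> Q A) ->
    Randoms t P `&` Randoms t Q = set0.

Definition blind_test (R : realType) (P : measures R) (t : Omega -> \bar R) :
    Prop :=
  [/\ lower_semicomputable t,
      forall w, (0 <= t w)%E
    & (\int[P]_w t w <= 1)%E].

Definition blindly_random (R : realType) (P : measures R) (w : Omega) : Prop :=
  forall t, blind_test P t -> (t w < +oo)%E.

(* Main.v *)
From Stdlib.Arith Require Cantor.
Require Import Defs.
From mathcomp Require Import all_boot all_order all_algebra.
From mathcomp Require Import all_classical all_reals all_analysis.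
From mathcomp Require Import measurable_realfun.
From mathcomp Require Import zify lra.

Set Implicit Arguments.
Unset Strict Implicit.
Unset Printing Implicit Defensive.

Import Order.TTheory GRing.Theory Num.Theory.

Local Open Scope classical_set_scope.
Local Open Scope nat_scope.

(** A blind test for [P] is trimmed into a uniform one: its open levels are
    enumerated in stages, and a stage is kept for a measure [Q] only once an open
    condition on [Q] certifies that it is small; hence uniform randomness implies
    blind randomness.

    Conversely, let [w] be blindly random for [P] in [C].  By effective compactness
    the infimum of [t w Q] over [Q] in [C] is lower semicomputable in [w], and it is
    a blind test for [P]; so [t w Q] is finite for some [Q] in [C].  If [Q] differed
    from [P], two basic sets [b0] and [b1] covering all measures would satisfy [Q]
    outside [b0] and [P] outside [b1].  For a rational [r >= t w Q], the set [U] of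
    the sequences [v] with [t v Q' > r] for all [Q'] in [C] outside [b0] is
    effectively open.  By orthogonality it has full measure for all [Q''] in [C]
    outside [b1], so by effective compactness its complement is covered by clopen
    sets of computably and uniformly small measure, and these form a blind test
    for [P] that rejects [w]. *)

(** * Computable functions between encoded types *)

Definition fstn (n : nat) : nat := (Cantor.of_nat n).1.
Definition sndn (n : nat) : nat := (Cantor.of_nat n).2.

Lemma fstnE n : (Cantor.of_nat n).1 = fstn n. Proof. by []. Qed.
Lemma sndnE n : (Cantor.of_nat n).2 = sndn n. Proof. by []. Qed.

Lemma fstn_pairn a b : fstn (pairn a b) = a.
Proof. by rewrite /fstn /pairn Cantor.cancel_of_to. Qed.

Lemma sndn_pairn a b : sndn (pairn a b) = b.
Proof. by rewrite /sndn /pairn Cantor.cancel_of_to. Qed.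

Lemma pairn_fstn_sndn n : pairn (fstn n) (sndn n) = n.
Proof. by rewrite /fstn /sndn /pairn -surjective_pairing Cantor.cancel_to_of. Qed.

Lemma pairn_inj a b a' b' : pairn a b = pairn a' b' -> a = a' /\ b = b'.
Proof.
by move=> e; split; [rewrite -(fstn_pairn a b) e fstn_pairn
                    |rewrite -(sndn_pairn a b) e sndn_pairn].
Qed.

Lemma leq_pairnr a b : b <= pairn a b.
Proof. have /ssrnat.leP := Cantor.to_nat_non_decreasing a b; rewrite -/(pairn a b); lia. Qed.

Lemma computes_functional c n m m' :
  computes c n m -> computes c n m' -> m = m'.
Proof.
elim: c n m m' => [||||f IHf g IHg|f IHf g IHg|f IHf g IHg|f IHf] n m m' /=;
  try by move=> -> ->.
- move=> [a [b [fa gb ->]]] [a' [b' [fa' gb' ->]]].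
  by rewrite (IHf _ _ _ fa fa') (IHg _ _ _ gb gb').
- move=> [k gk fk] [k' gk' fk'].
  by rewrite -(IHg _ _ _ gk gk') in fk'; apply: IHf fk fk'.
- move=> [s [s0 sS ->]] [s' [s'0 s'S ->]].
  suff H : forall i, i <= (Cantor.of_nat n).2 -> s i = s' i by apply: H.
  elim=> [_|i IHi lti]; first exact: IHf s0 s'0.
  by apply: IHg (sS _ lti) _; rewrite IHi ?(ltnW lti)//; apply: s'S.
- move=> [fm ltm] [fm' ltm'].
  have [lt|lt|//] := ltngtP m m'.
  + by have [k fk] := ltm' _ lt; have := IHf _ _ _ fm fk.
  + by have [k fk] := ltm _ lt; have := IHf _ _ _ fm' fk.
Qed.

Definition computable (F : nat -> nat) : Prop :=
  exists c, forall n, computes c n (F n).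

Lemma computable_id : computable id.
Proof.
exists (Pair Left Right) => n; exists (fstn n), (sndn n).
by rewrite pairn_fstn_sndn.
Qed.

Lemma computable_comp F G :
  computable F -> computable G -> computable (fun n => F (G n)).
Proof. by move=> [c cF] [d dG]; exists (Comp c d) => n; exists (G n). Qed.

Lemma computable_const k : computable (fun=> k).
Proof.
elim: k => [|k IHk]; first by exists Zero.
by apply: (@computable_comp succn) IHk; exists Succ.
Qed.

Lemma computable_pair F G :
  computable F -> computable G -> computable (fun n => pairn (F n) (G n)).
Proof. by move=> [c cF] [d dG]; exists (Pair c d) => n; exists (F n), (G n). Qed.

Lemma computable_fstn : computable fstn. Proof. by exists Left. Qed.
Lemma computable_sndn : computable sndn. Proof. by exists Right. Qed.

(** The sequence of values that [Prec] asks for is given by the iterates themselves. *)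
Lemma computable_iteri F G : computable F -> computable G ->
  computable (fun n => iteri (sndn n)
    (fun i s => G (pairn (fstn n) (pairn i s))) (F (fstn n))).
Proof.
move=> [c cF] [d dG]; exists (Prec c d) => n /=.
by exists (fun k => iteri k (fun i s => G (pairn (fstn n) (pairn i s))) (F (fstn n))).
Qed.

(* Unification would otherwise unfold the Cantor pairing. *)
#[local] Opaque fstn sndn pairn.

(** The decidable range [valid] lets an unbounded search over numbers discard those that code no
    object. *)
Class coded (T : Type) := Coded {
  encode : T -> nat;
  encode_inj : injective encode;
  valid : nat -> bool;
  computable_valid : computable valid;
  validP : forall n, valid n <-> exists x, encode x = n }.

(** The realizer [F] is total on numbers, but its values off the range of [encode] are arbitrary. *)
Definition cfun {A B : Type} {cA : coded A} {cB : coded B} (f : A -> B) : Prop :=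
  exists2 F, computable F & forall a, encode (f a) = F (encode a).

#[export] Instance coded_nat : coded nat.
Proof.
refine (@Coded nat id (fun _ _ => id) (fun=> true) (computable_const 1) _).
by move=> n; split=> // _; exists n.
Defined.

Lemma cfun_computable (F : nat -> nat) : computable F <-> cfun F.
Proof.
split=> [cF|[G cG FG]]; first by exists F.
by have -> : F = G by apply/funext.
Qed.

Section Combinators.
Context {A B C : Type} {cA : coded A} {cB : coded B} {cC : coded C}.

Lemma cfun_id : cfun (@id A).
Proof. by exists id => //; apply: computable_id. Qed.

Lemma cfun_const (b : B) : cfun (fun _ : A => b).
Proof. by exists (fun=> encode b) => //; apply: computable_const. Qed.

Lemma cfun_comp (g : B -> C) (f : A -> B) :
  cfun g -> cfun f -> cfun (fun a => g (f a)).
Proof.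
move=> [G cG gG] [F cF fF]; exists (fun n => G (F n)); first exact: computable_comp.
by move=> a; rewrite gG fF.
Qed.

Lemma cfun_encode (f : A -> B) : cfun f -> cfun (fun a => encode (f a)).
Proof. by move=> [F cF fF]; exists F. Qed.

Lemma cfun_ext (f g : A -> B) : f =1 g -> cfun f -> cfun g.
Proof. by move=> fg [F cF fF]; exists F => // a; rewrite -fg. Qed.

End Combinators.

(** Recursion replaces branching: [H n] is iterated [F n] times under a step that always returns
    [G n]. *)
Lemma computable_if F G H : computable F -> computable G -> computable H ->
  computable (fun n => if F n is 0 then H n else G n).
Proof.
move=> cF cG cH.
have := computable_comp (computable_iteri cH
   (computable_comp cG computable_fstn)) (computable_pair computable_id cF).
congr computable; apply/funext => n.
by rewrite sndn_pairn fstn_pairn; case: (F n) => //= k; rewrite fstn_pairn.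
Qed.

#[export] Instance coded_bool : coded bool.
Proof.
refine (@Coded bool nat_of_bool _ (fun n => n < 2) _ _).
- by case=> [] [].
- have := computable_if computable_id (computable_if (F := predn)
     (G := fun=> 0) (H := fun=> 1) _ _ _) (computable_const 1).
  have pr : computable predn.
    have := computable_comp (computable_iteri (computable_const 0)
      (computable_comp computable_fstn computable_sndn))
      (computable_pair (computable_const 0) computable_id).
    congr computable; apply/funext => n; rewrite sndn_pairn.
    by case: n => //= n; rewrite sndn_pairn fstn_pairn.
  move=> /(_ pr (computable_const 0) (computable_const 1)).
  by congr computable; apply/funext => -[|[|n]].
- move=> n; split=> [|[b <-]]; last by case: b.
  by case: n => [|[|]]// _; [exists false|exists true].
Defined.

Lemma cfun_computable_bool (b : nat -> bool) : computable b <-> cfun b.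
Proof.
split=> [cb|[F cF bF]]; first by exists b.
suff -> : (b : nat -> nat) = F by [].
by apply/funext => n; exact: bF.
Qed.

Lemma cfun_if {A B : Type} {cA : coded A} {cB : coded B} (c : A -> bool)
    (f g : A -> B) : cfun c -> cfun f -> cfun g ->
  cfun (fun a => if c a then f a else g a).
Proof.
move=> [H cH hH] [F cF fF] [G cG gG].
exists (fun n => if H n is 0 then G n else F n); first exact: computable_if.
by move=> a; rewrite -hH; case: (c a).
Qed.

Section BoolLogic.
Context {A : Type} {cA : coded A}.

Lemma cfun_and (f g : A -> bool) : cfun f -> cfun g -> cfun (fun a => f a && g a).
Proof. by move=> cf cg; apply: cfun_if => //; apply: cfun_const. Qed.

Lemma cfun_or (f g : A -> bool) : cfun f -> cfun g -> cfun (fun a => f a || g a).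
Proof. by move=> cf cg; apply: cfun_if => //; apply: cfun_const. Qed.

Lemma cfun_neg (f : A -> bool) : cfun f -> cfun (fun a => ~~ f a).
Proof. by move=> cf; apply: cfun_if => //; apply: cfun_const. Qed.

Lemma cfun_implb (f g : A -> bool) : cfun f -> cfun g -> cfun (fun a => f a ==> g a).
Proof. by move=> cf cg; apply: cfun_if => //; apply: cfun_const. Qed.

End BoolLogic.

#[export] Instance coded_prod (A B : Type) (cA : coded A) (cB : coded B) :
  coded (A * B).
Proof.
refine (@Coded (A * B) (enc_prod encode encode) _
  (fun n => valid (coded := cA) (fstn n) && valid (coded := cB) (sndn n)) _ _).
- by move=> [a b] [a' b'] /pairn_inj[/= ea eb]; congr pair; apply: encode_inj.
- apply/(cfun_computable_bool (fun n => _ && _)).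
  apply: cfun_and; apply/cfun_computable_bool.
  + exact: computable_comp computable_valid computable_fstn.
  + exact: computable_comp computable_valid computable_sndn.
- move=> n; split=> [/andP[/validP[a ea] /validP[b eb]]|[[a b] <-]].
    by exists (a, b); rewrite /enc_prod ea eb pairn_fstn_sndn.
  rewrite /enc_prod fstn_pairn sndn_pairn; apply/andP; split.
    by apply/validP; exists a.
  by apply/validP; exists b.
Defined.

Section Products.
Context {A B C : Type} {cA : coded A} {cB : coded B} {cC : coded C}.

Lemma cfun_pair (f : A -> B) (g : A -> C) :
  cfun f -> cfun g -> cfun (fun a => (f a, g a)).
Proof.
move=> [F cF fF] [G cG gG]; exists (fun n => pairn (F n) (G n)).
  exact: computable_pair.
by move=> a; rewrite -fF -gG.
Qed.

Lemma cfun_fst (f : A -> B * C) : cfun f -> cfun (fun a => (f a).1).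
Proof.
apply: (cfun_comp (g := fst)); exists fstn; first exact: computable_fstn.
by move=> a; rewrite fstn_pairn.
Qed.

Lemma cfun_snd (f : A -> B * C) : cfun f -> cfun (fun a => (f a).2).
Proof.
apply: (cfun_comp (g := snd)); exists sndn; first exact: computable_sndn.
by move=> a; rewrite sndn_pairn.
Qed.

Lemma cfun_iteri (k : A -> nat) (g : A -> nat -> B -> B) (f : A -> B) :
  cfun k -> cfun (fun p : A * nat * B => g p.1.1 p.1.2 p.2) -> cfun f ->
  cfun (fun a => iteri (k a) (g a) (f a)).
Proof.
move=> [K cK kK] [G cG gG] [F cF fF].
(* Primitive recursion supplies [pairn a (pairn i s)], whereas the code of the triple [(a, i, s)]
   nests to the left; [G'] converts between the two. *)
pose G' n := G (pairn (pairn (fstn n) (fstn (sndn n))) (sndn (sndn n))).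
exists (fun n => iteri (K n) (fun i s => G' (pairn n (pairn i s))) (F n)).
  have cG' : computable G'.
    apply: computable_comp cG _.
    have css := computable_comp computable_sndn computable_sndn.
    apply: computable_pair css; apply: computable_pair computable_fstn _.
    exact: computable_comp computable_fstn computable_sndn.
  have := computable_comp (computable_iteri cF cG') (computable_pair computable_id cK).
  by congr computable; apply/funext => n; rewrite fstn_pairn sndn_pairn.
move=> a; rewrite -kK; elim: (k a) => [|i IHi] //=.
rewrite -IHi /G' !(fstn_pairn, sndn_pairn).
by rewrite (gG (a, i, iteri i (g a) (f a))).
Qed.

End Products.

(** * Arithmetic, equality and bounded search *)

Section Arithmetic.
Context {A : Type} {cA : coded A}.
Implicit Types f g : A -> nat.

Lemma cfun_fstn f : cfun f -> cfun (fun a => fstn (f a)).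
Proof. by apply: (cfun_comp (g := fstn)); apply/cfun_computable/computable_fstn. Qed.

Lemma cfun_sndn f : cfun f -> cfun (fun a => sndn (f a)).
Proof. by apply: (cfun_comp (g := sndn)); apply/cfun_computable/computable_sndn. Qed.

Lemma cfun_pairn f g : cfun f -> cfun g -> cfun (fun a => pairn (f a) (g a)).
Proof.
move=> [F cF fF] [G cG gG]; exists (fun n => pairn (F n) (G n)).
  exact: computable_pair.
by move=> a; rewrite -fF -gG.
Qed.

Lemma cfun_succ f : cfun f -> cfun (fun a => (f a).+1).
Proof. by apply: (cfun_comp (g := succn)); apply/cfun_computable; exists Succ. Qed.

(** A step that returns its own index leaves the last index after [f a] iterations. *)
Lemma cfun_pred f : cfun f -> cfun (fun a => (f a).-1).
Proof.
move=> cf; apply: (cfun_ext (f := fun a => iteri (f a) (fun i _ => i) 0)).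
  by move=> a; case: (f a).
apply: (cfun_iteri (g := fun _ i _ => i)) cf _ (cfun_const 0).
exact/cfun_snd/cfun_fst/cfun_id.
Qed.

End Arithmetic.

Ltac cfun_step := cbv beta; first [ assumption | exact: cfun_id | exact: cfun_const
  | lazymatch goal with
  | |- cfun (fun x => (@?f x, @?g x)) => apply: cfun_pair
  | |- cfun fst => exact: (cfun_fst cfun_id)
  | |- cfun snd => exact: (cfun_snd cfun_id)
  | |- cfun fstn => exact: (cfun_fstn cfun_id)
  | |- cfun sndn => exact: (cfun_sndn cfun_id)
  | |- cfun (fun x => (@?f x).1) => apply: cfun_fst
  | |- cfun (fun x => (@?f x).2) => apply: cfun_snd
  | |- cfun (fun x => @?f x && @?g x) => apply: cfun_and
  | |- cfun (fun x => @?f x || @?g x) => apply: cfun_or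
  | |- cfun (fun x => @?f x ==> @?g x) => apply: cfun_implb
  | |- cfun (fun x => ~~ @?f x) => apply: cfun_neg
  | |- cfun (fun x => (@?f x).+1) => apply: cfun_succ
  | |- cfun (fun x => (@?f x).-1) => apply: cfun_pred
  | |- cfun (fun x => fstn (@?f x)) => apply: cfun_fstn
  | |- cfun (fun x => sndn (@?f x)) => apply: cfun_sndn
  | |- cfun (fun x => pairn (@?f x) (@?g x)) => apply: cfun_pairn
  end
  | match goal with H : cfun ?f |- cfun (fun x => ?f (@?u x)) =>
      apply: (cfun_comp (g := f) H) end
  | apply: cfun_if ].

Section MoreArithmetic.
Context {A : Type} {cA : coded A}.
Implicit Types f g : A -> nat.

Lemma cfun_addn f g : cfun f -> cfun g -> cfun (fun a => f a + g a).
Proof.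
move=> cf cg; apply: (cfun_ext (f := fun a => iteri (g a) (fun _ s => s.+1) (f a))).
  by move=> a; elim: (g a) => [|k /= ->]; rewrite ?addn0 ?addnS.
by apply: (cfun_iteri (g := fun _ _ s => s.+1)) => //; repeat cfun_step.
Qed.

Lemma cfun_subn f g : cfun f -> cfun g -> cfun (fun a => f a - g a).
Proof.
move=> cf cg; apply: (cfun_ext (f := fun a => iteri (g a) (fun _ s => s.-1) (f a))).
  by move=> a; elim: (g a) => [|k /= ->]; rewrite ?subn0 ?subnS.
by apply: (cfun_iteri (g := fun _ _ s => s.-1)) => //; repeat cfun_step.
Qed.

Lemma cfun_eq0 f : cfun f -> cfun (fun a => f a == 0).
Proof.
move=> cf; apply: (cfun_ext (f := fun a => iteri (f a) (fun _ _ => false) true)).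
  by move=> a; case: (f a).
by apply: (cfun_iteri (g := fun _ _ _ => false)) => //; repeat cfun_step.
Qed.

Lemma cfun_leq f g : cfun f -> cfun g -> cfun (fun a => f a <= g a).
Proof. by move=> cf cg; apply: cfun_eq0; apply: cfun_subn. Qed.

Lemma cfun_eq {B : eqType} {cB : coded B} (h k : A -> B) :
  cfun h -> cfun k -> cfun (fun a => h a == k a).
Proof.
move=> /cfun_encode ch /cfun_encode ck.
apply: (cfun_ext (f := fun a => (encode (h a) <= encode (k a)) &&
                                (encode (k a) <= encode (h a)))).
  by move=> a /=; rewrite -eqn_leq (inj_eq encode_inj).
by apply: cfun_and; apply: cfun_leq.
Qed.

End MoreArithmetic.

Ltac cfun_step2 := first [ cfun_step | lazymatch goal with
  | |- cfun (fun x => @?f x + @?g x) => apply: cfun_addn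
  | |- cfun (fun x => @?f x - @?g x) => apply: cfun_subn
  | |- cfun (fun x => @?f x <= @?g x) => apply: cfun_leq
  | |- cfun (fun x => @?f x == @?g x) => apply: cfun_eq
  end ].

Lemma cfun_muln {A : Type} {cA : coded A} (f g : A -> nat) :
  cfun f -> cfun g -> cfun (fun a => f a * g a).
Proof.
move=> cf cg; apply: (cfun_ext (f := fun a => iteri (g a) (fun _ s => f a + s) 0)).
  by move=> a; elim: (g a) => [|k /= ->]; rewrite ?muln0 ?mulnS.
by apply: (cfun_iteri (g := fun a _ s => f a + s)) => //; repeat cfun_step2.
Qed.

Lemma cfun_expn {A : Type} {cA : coded A} k (f : A -> nat) :
  cfun f -> cfun (fun a => k ^ f a).
Proof.
move=> cf; apply: (cfun_ext (f := fun a => iteri (f a) (fun _ s => k * s) 1)).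
  by move=> a; elim: (f a) => [|i /= ->]; rewrite ?expnS.
apply: (cfun_iteri (g := fun _ _ s => k * s)) => //; repeat cfun_step2.
by apply: cfun_muln; repeat cfun_step2.
Qed.

Section BoundedSearch.
Context {A : Type} {cA : coded A}.
Implicit Types f : A -> nat.

Lemma cfun_has_iota (p : A -> nat -> bool) f :
  cfun (fun x : A * nat => p x.1 x.2) -> cfun f ->
  cfun (fun a => has (p a) (iota 0 (f a))).
Proof.
move=> cp cf.
apply: (cfun_ext (f := fun a => iteri (f a) (fun i s => s || p a i) false)).
  move=> a; elim: (f a) => // i IHi.
  by rewrite -[in RHS]addn1 iotaD has_cat /= orbF -IHi.
apply: (cfun_iteri (g := fun a i s => s || p a i)) => //; repeat cfun_step2.
apply: (cfun_comp (g := fun x => p x.1 x.2) (f := @fst (A * nat) bool)) => //.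
by repeat cfun_step2.
Qed.

Lemma cfun_all_iota (p : A -> nat -> bool) f :
  cfun (fun x : A * nat => p x.1 x.2) -> cfun f ->
  cfun (fun a => all (p a) (iota 0 (f a))).
Proof.
move=> cp cf.
apply: (cfun_ext (f := fun a => ~~ has (fun i => ~~ p a i) (iota 0 (f a)))).
  by move=> a /=; rewrite -all_predC; apply: eq_all => i /=; rewrite negbK.
by apply/cfun_neg/(cfun_has_iota (p := fun a i => ~~ p a i)) => //; repeat cfun_step2.
Qed.

End BoundedSearch.

(** * Lists and folds over them *)

Section Sequences.

Lemma enc_seq_natP n : exists s : seq nat, enc_seq id s = n.
Proof.
elim/ltn_ind: n => -[|n] IHn; first by exists [::].
have [|s es] := IHn (sndn n).
  by rewrite ltnS -{2}(pairn_fstn_sndn n) leq_pairnr.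
by exists (fstn n :: s); rewrite /= es pairn_fstn_sndn.
Qed.

Lemma size_enc_seq T (e : T -> nat) (s : seq T) : size s <= enc_seq e s.
Proof. by elim: s => //= x s IHs; rewrite ltnS (leq_trans IHs) ?leq_pairnr. Qed.

(** The state pairs the code of the remaining list with the accumulator, and is fixed once the list
    is empty. The code of a list bounds its length, so it can serve as the number of iterations in
    [foldn]. *)
Let step (G : nat -> nat) (x : nat) (st : nat * nat) : nat * nat :=
  if st.1 == 0 then st else
  (sndn st.1.-1, G (pairn (pairn x st.2) (fstn st.1.-1))).

Let foldn (G : nat -> nat) (x l s : nat) : nat :=
  (iteri l (fun _ => step G x) (l, s)).2.

Let foldn_foldl T U (e : T -> nat) (e' : U -> nat) G x (f : U -> T -> U) l s :
  (forall u v, e' (f u v) = G (pairn (pairn x (e' u)) (e v))) ->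
  foldn G x (enc_seq e l) (e' s) = e' (foldl f s l).
Proof.
move=> fG; rewrite /foldn.
suff H : forall n l s, size l <= n ->
    iteri n (fun=> step G x) (enc_seq e l, e' s) = (0, e' (foldl f s l)).
  by rewrite H ?size_enc_seq.
move=> {l s} n; have iteriSr (h : nat * nat -> nat * nat) k u :
    iteri k.+1 (fun=> h) u = iteri k (fun=> h) (h u).
  by elim: k => //= k ->.
elim: n => [|n IHn] [|y l] s // ln; rewrite iteriSr.
  by rewrite [step _ _ _]/step /= (IHn [::]).
by rewrite [step _ _ _]/step /= fstn_pairn sndn_pairn -fG IHn.
Qed.

Let computable_foldn F L S G : computable F -> computable L -> computable S ->
  computable G -> computable (fun n => foldn G (F n) (L n) (S n)).
Proof.
move=> /cfun_computable cF /cfun_computable cL /cfun_computable cS.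
move=> /cfun_computable cG; apply/cfun_computable; apply: cfun_snd.
apply: (cfun_iteri (g := fun n _ => step G (F n))) => //; last by repeat cfun_step.
by rewrite /step; repeat cfun_step2.
Qed.

Lemma enc_seq_inj T (e : T -> nat) : injective e -> injective (enc_seq e).
Proof.
move=> e_inj; elim=> [|x s IHs] [|y s']//= -[] /pairn_inj[exy exs].
by congr cons; [apply: e_inj|apply: IHs].
Qed.

Lemma enc_seq_map T (e : T -> nat) s : enc_seq id (map e s) = enc_seq e s.
Proof. by elim: s => //= x s ->. Qed.

(** Every number codes a list of numbers, so only the entries have to be tested. Inside the fold
    [fstn x] is the pairing of 0 with the boolean accumulator, and it vanishes exactly when the
    accumulator is false. *)
Let valid_seq (v : nat -> bool) (n : nat) : bool :=
  foldn (fun x => (fstn x != 0) && v (sndn x)) 0 n 1 != 0.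

Let valid_seqE v (s : seq nat) : valid_seq v (enc_seq id s) = all v s.
Proof.
rewrite /valid_seq.
rewrite (@foldn_foldl nat bool id nat_of_bool _ _ (fun b n => b && v n) _ true).
  elim/last_ind: s => // s y.
  by rewrite foldl_rcons all_rcons !eqb0 !negbK => ->; rewrite andbC.
by move=> u n; rewrite !(fstn_pairn, sndn_pairn); case: u.
Qed.

Let computable_valid_seq (v : nat -> bool) : computable v -> computable (valid_seq v).
Proof.
move=> cv; apply/cfun_computable_bool; apply/cfun_neg/cfun_eq; last exact: cfun_const.
apply/cfun_computable; apply: computable_foldn (computable_const 0) computable_id
  (computable_const 1) _.
apply/(cfun_computable_bool (fun n => _ && _)).
apply: cfun_and; last first.
  exact/cfun_computable_bool/(computable_comp cv computable_sndn).
apply: cfun_neg; apply: cfun_eq; last exact: cfun_const.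
exact/cfun_computable/computable_fstn.
Qed.

Let valid_seqP (A : Type) (cA : coded A) n :
  valid_seq (valid (coded := cA)) n <-> exists s, enc_seq (encode (coded := cA)) s = n.
Proof.
split=> [|[s <-]]; last first.
  rewrite -enc_seq_map valid_seqE; elim: s => //= x s ->; rewrite andbT.
  by apply/validP; exists x.
have [s <-] := enc_seq_natP n; rewrite valid_seqE => vs.
suff [s' <-] : exists s', map (encode (coded := cA)) s' = s by exists s'; rewrite -enc_seq_map.
elim: s vs => [|x s IHs] /=; first by exists [::].
case/andP => vx /IHs[s' es']; have [y ey] := (validP (coded := cA) x).1 vx.
by exists (y :: s'); rewrite /= ey es'.
Qed.

#[export] Instance coded_seq (A : Type) (cA : coded A) : coded (seq A) :=
  @Coded (seq A) (enc_seq encode) (enc_seq_inj encode_inj) (valid_seq valid)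
    (computable_valid_seq computable_valid) (@valid_seqP A cA).

Lemma cfun_foldl {A B C : Type} {cA : coded A} {cB : coded B} {cC : coded C}
    (f : A -> C -> B -> C) (s : A -> C) (l : A -> seq B) :
  cfun (fun p : A * C * B => f p.1.1 p.1.2 p.2) -> cfun s -> cfun l ->
  cfun (fun a => foldl (f a) (s a) (l a)).
Proof.
move=> [F cF fF] [S cS sS] [L cL lL].
exists (fun n => foldn F n (L n) (S n)).
  exact: computable_foldn computable_id cL cS cF.
move=> a; rewrite -lL -sS; symmetry; apply: foldn_foldl => u v.
by rewrite (fF (a, u, v)).
Qed.

End Sequences.

Lemma cfun_cons {A B : Type} {cA : coded A} {cB : coded B}
    (x : A -> B) (s : A -> seq B) : cfun x -> cfun s -> cfun (fun a => x a :: s a).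
Proof.
move=> [X cX xX] [S cS sS]; exists (fun n => (pairn (X n) (S n)).+1).
  by apply: (computable_comp (F := succn)); [exists Succ|apply: computable_pair].
by move=> a /=; rewrite -xX; congr (pairn _ _).+1; apply: sS.
Qed.

Ltac cfun_step3 := first [ cfun_step2 | lazymatch goal with
  | |- cfun (fun x => @?f x * @?g x) => apply: cfun_muln
  | |- cfun (fun x => _ ^ @?g x) => apply: cfun_expn
  | |- cfun (fun x => @?f x :: @?g x) => apply: cfun_cons
  | |- cfun (fun x => has (@?f x) (iota 0 (@?g x))) => apply: cfun_has_iota
  | |- cfun (fun x => all (@?f x) (iota 0 (@?g x))) => apply: cfun_all_iota
  end ].

Ltac cfun_tac := repeat cfun_step3.

Section ListFunctions.
Context {A B : Type} {cA : coded A} {cB : coded B}.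

Lemma cfun_has (p : A -> B -> bool) (l : A -> seq B) :
  cfun (fun x : A * B => p x.1 x.2) -> cfun l -> cfun (fun a => has (p a) (l a)).
Proof.
move=> cp cl.
apply: (cfun_ext (f := fun a => foldl (fun b x => b || p a x) false (l a))).
  move=> a; elim/last_ind: (l a) => // s x.
  by rewrite foldl_rcons has_rcons orbC => ->.
apply: (cfun_foldl (f := fun a b x => b || p a x)) => //; cfun_tac.
apply: (cfun_comp (g := fun x => p x.1 x.2)
         (f := fun q : A * bool * B => (q.1.1, q.2))) => //; cfun_tac.
Qed.

Lemma cfun_all (p : A -> B -> bool) (l : A -> seq B) :
  cfun (fun x : A * B => p x.1 x.2) -> cfun l -> cfun (fun a => all (p a) (l a)).
Proof.
move=> cp cl.
apply: (cfun_ext (f := fun a => ~~ has (fun x => ~~ p a x) (l a))).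
  by move=> a /=; rewrite -all_predC; apply: eq_all => i /=; rewrite negbK.
by apply/cfun_neg/(cfun_has (p := fun a x => ~~ p a x)) => //; cfun_tac.
Qed.

Lemma cfun_size (l : A -> seq B) : cfun l -> cfun (fun a => size (l a)).
Proof.
move=> cl; apply: (cfun_ext (f := fun a => foldl (fun n _ => n.+1) 0 (l a))).
  by move=> a; elim/last_ind: (l a) => // s x; rewrite foldl_rcons size_rcons => ->.
by apply: (cfun_foldl (f := fun _ n _ => n.+1)) => //; cfun_tac.
Qed.

Lemma cfun_nth (d : B) (l : A -> seq B) (i : A -> nat) : cfun l -> cfun i ->
  cfun (fun a => nth d (l a) (i a)).
Proof.
(* The fold counts positions in the first component and captures the entry met at position [k] in
   the second. *)
move=> cl ci; pose f (k : nat) (st : nat * B) x :=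
  (st.1.+1, if st.1 == k then x else st.2).
apply: (cfun_ext (f := fun a => (foldl (f (i a)) (0, d) (l a)).2)).
  move=> a; suff -> : foldl (f (i a)) (0, d) (l a) = (size (l a), nth d (l a) (i a)) by [].
  elim/last_ind: (l a) => [|s x IHs]; first by rewrite nth_nil.
  rewrite foldl_rcons IHs size_rcons nth_rcons /f /= eq_sym.
  case: ltngtP => //= h; by rewrite nth_default// ltnW.
apply: cfun_snd; apply: (cfun_foldl (f := fun a => f (i a))); rewrite /f; cfun_tac.
Qed.

End ListFunctions.

Section Divisibility.
Context {A : Type} {cA : coded A}.
Implicit Types f g : A -> nat.

Lemma cfun_odd f : cfun f -> cfun (fun a => odd (f a)).
Proof.
move=> cf; apply: (cfun_ext (f := fun a => iteri (f a) (fun _ b => ~~ b) false)).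
  by move=> a; elim: (f a) => //= k ->.
by apply: (cfun_iteri (g := fun _ _ b => ~~ b)) => //; cfun_tac.
Qed.

Lemma cfun_uphalf f : cfun f -> cfun (fun a => uphalf (f a)).
Proof.
(* The recursion rests on [uphalf k + uphalf k.+1 = k.+1]. *)
move=> cf; apply: (cfun_ext (f := fun a => iteri (f a) (fun k s => k.+1 - s) 0)).
  by move=> a; elim: (f a) => //= k ->; have := odd_double_half k; rewrite uphalfE; lia.
by apply: (cfun_iteri (g := fun _ k s => k.+1 - s)) => //; cfun_tac.
Qed.

Lemma cfun_dvdn f g : cfun f -> cfun g -> cfun (fun a => f a %| g a).
Proof.
move=> cf cg.
apply: (cfun_ext (f := fun a => has (fun j => j * f a == g a) (iota 0 (g a).+1))).
  move=> a; apply/hasP/dvdnP => [[j _ /eqP <-]|[j gE]]; first by exists j.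
  have [f0|f0] := posnP (f a).
    by exists 0 => //; rewrite gE f0 !muln0.
  exists j; last by rewrite gE.
  by rewrite mem_iota /= ?add0n ltnS gE leq_pmulr.
by apply: (cfun_has_iota (p := fun a j => j * f a == g a)); cfun_tac.
Qed.

End Divisibility.

Section Coprimality.
Context {A : Type} {cA : coded A}.
Implicit Types f g : A -> nat.

(** Common divisors greater than 1 are searched up to [g a]; positivity of [g a] puts the gcd within
    that range. *)
Lemma cfun_coprime f g : cfun f -> cfun g ->
  cfun (fun a => (0 < g a) && coprime (f a) (g a)).
Proof.
move=> cf cg.
pose p a i := (1 < i) && ((i %| f a) && (i %| g a)).
apply: (cfun_ext (f := fun a => (0 < g a) && ~~ has (p a) (iota 0 (g a).+1))).
  move=> a; have [//|g0 /=] := posnP (g a).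
  apply/hasPn/idP => [H|cop i _]; last first.
    apply/negP => /andP[i1 /andP[fi gi]].
    have := dvdn_gcd i (f a) (g a); rewrite fi gi (eqP cop) dvdn1 /=.
    by move=> /eqP i1'; rewrite i1' in i1.
  have gcd0 : 0 < gcdn (f a) (g a) by rewrite gcdn_gt0 g0 orbT.
  have := H (gcdn (f a) (g a)); rewrite mem_iota add1n ltnS gcd0.
  rewrite dvdn_leq ?dvdn_gcdr// => /(_ isT); rewrite /p dvdn_gcdl dvdn_gcdr !andbT.
  by rewrite /coprime; case: gcdn gcd0 => // -[].
by cfun_tac; rewrite /p; cfun_tac; apply: cfun_dvdn; cfun_tac.
Qed.

End Coprimality.

(** * Codes of integers and rationals *)

Lemma absz_enc_int (z : int) : `|z|%N = uphalf (enc_int z).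
Proof. by case: z => n /=; rewrite ?uphalf_double ?doubleK //. Qed.

Lemma enc_int_inj : injective enc_int.
Proof.
move=> [m|m] [n|n] /= e.
- by rewrite (double_inj e).
- by move/(congr1 odd): e; rewrite /= !odd_double.
- by move/(congr1 odd): e; rewrite /= !odd_double.
- by case: e => /double_inj ->.
Qed.

Lemma enc_intP n : exists z, enc_int z = n.
Proof.
case: (boolP (odd n)) => [on|/negbTE on].
  by exists (Negz n./2); rewrite /= -[RHS]odd_double_half on.
by exists (Posz n./2); rewrite /= -[RHS]odd_double_half on.
Qed.

(** The codes in the range are those of reduced fractions with positive denominator; [uphalf]
    recovers the absolute value of the numerator from its code. *)
Definition valid_rat (n : nat) : bool :=
  (0 < sndn n) && coprime (uphalf (fstn n)) (sndn n).

Lemma computable_valid_rat : computable valid_rat.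
Proof.
apply/cfun_computable_bool/cfun_coprime; last exact/cfun_computable/computable_sndn.
exact/cfun_uphalf/cfun_computable/computable_fstn.
Qed.

Lemma enc_rat_inj : injective enc_rat.
Proof.
move=> p q /pairn_inj[/enc_int_inj ep ed].
rewrite -[p]divq_num_den -[q]divq_num_den ep; congr (_ / _%:~R)%R.
by rewrite -[denq p]absz_denq -[denq q]absz_denq ed.
Qed.

Lemma valid_ratP n : valid_rat n <-> exists q, enc_rat q = n.
Proof.
split=> [/andP[d0 cop]|[q <-]].
  have [z ez] := enc_intP (fstn n).
  exists (z%:~R / (sndn n)%:~R)%R.
  have cop' : coprime `|z| `|Posz (sndn n)| by rewrite absz_enc_int ez.
  rewrite /enc_rat (coprimeq_num cop') (coprimeq_den cop').
  have -> : (Posz (sndn n) == 0%R) = false by rewrite -absz_eq0; case: sndn d0.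
  rewrite gtr0_sg; last by case: sndn d0.
  by rewrite mul1r ez /= pairn_fstn_sndn.
rewrite /valid_rat fstn_pairn sndn_pairn -absz_enc_int coprime_num_den andbT.
by rewrite absz_gt0 denq_neq0.
Qed.

#[export] Instance coded_rat : coded rat :=
  @Coded rat enc_rat enc_rat_inj valid_rat computable_valid_rat valid_ratP.

Lemma cfun_natr {A : Type} {cA : coded A} (f : A -> nat) :
  cfun f -> cfun (fun a => (f a)%:R%R : rat).
Proof.
apply: (cfun_comp (g := fun n => n%:R%R : rat)).
(* The nonnegative numerator [n] is coded by its double, and the denominator is 1. *)
have [F cF FE] : cfun (fun n : nat => (n + n, 1)) by cfun_tac.
exists F => // n; rewrite -[in RHS]FE /=.
by rewrite /enc_rat /enc_prod /= -[n%:R%R]/((Posz n)%:~R : rat)%R numq_int denq_int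
  /= addnn.
Qed.

Lemma cfun_ltr_rat {A : Type} {cA : coded A} (q : A -> rat) (m M : A -> nat) :
  cfun q -> cfun m -> cfun M ->
  cfun (fun a => (q a * (M a).+1%:R < (m a)%:R)%R).
Proof.
move=> cq cm cM.
have cf : cfun (fun q => fstn (encode (q : rat))).
  by exists fstn => //; apply: computable_fstn.
have cs : cfun (fun q => sndn (encode (q : rat))).
  by exists sndn => //; apply: computable_sndn.
(* An odd first component encodes a negative numerator. *)
apply: (cfun_ext (f := fun a => odd (fstn (encode (q a))) ||
  (uphalf (fstn (encode (q a))) * (M a).+1 < m a * sndn (encode (q a))))).
  move=> a /=; rewrite /enc_rat fstn_pairn sndn_pairn -absz_enc_int.
  rewrite -[in RHS](divq_num_den (q a)).
  rewrite mulrAC ltr_pdivrMr; last by rewrite ltr0z denq_gt0.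
  rewrite -[in RHS]absz_denq -!natrM.
  case: (numq (q a)) => n /=; last first.
    rewrite odd_double /=; symmetry; rewrite NegzE.
    rewrite mulrNz mulNr (@lt_le_trans _ _ 0%R)// ?oppr_lt0 ?mulr_gt0// ?ler0n//.
  by rewrite odd_double /= -[(n%:~R)%R]/(n%:R : rat)%R -natrM ltr_nat.
by apply: cfun_or; [apply/cfun_odd|apply/cfun_leq; [apply/cfun_succ/cfun_muln;
  [apply: cfun_uphalf|]|apply: cfun_muln]]; cfun_tac.
Qed.

(** * Semidecidable sets *)

Definition semidecidable {A : Type} {cA : coded A} (S : A -> Prop) : Prop :=
  exists2 f : A * nat -> bool, cfun f & forall a, S a <-> exists k, f (a, k).

Section Semidecidable.
Context {A B : Type} {cA : coded A} {cB : coded B}.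

Lemma semidec_ext (S T : A -> Prop) :
  (forall a, S a <-> T a) -> semidecidable S -> semidecidable T.
Proof. by move=> ST [f cf fS]; exists f => // a; rewrite -ST. Qed.

Lemma semidec_bool (b : A -> bool) : cfun b -> semidecidable (fun a => b a).
Proof.
move=> cb; exists (fun p => b p.1); first by cfun_tac.
by move=> a; split=> [|[]]//; exists 0.
Qed.

Lemma semidec_comp (S : B -> Prop) (f : A -> B) :
  semidecidable S -> cfun f -> semidecidable (fun a => S (f a)).
Proof.
move=> [g cg gS] cf; exists (fun p => g (f p.1, p.2)); first by cfun_tac.
by move=> a; apply: gS.
Qed.

Lemma semidec_and (S T : A -> Prop) :
  semidecidable S -> semidecidable T -> semidecidable (fun a => S a /\ T a).
Proof.
move=> [f cf fS] [g cg gT].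
exists (fun p => f (p.1, fstn p.2) && g (p.1, sndn p.2)); first by cfun_tac.
move=> a; rewrite fS gT; split=> [[[i fi] [j gj]]|[k /andP[fk gk]]].
  by exists (pairn i j); rewrite fstn_pairn sndn_pairn fi gj.
by split; [exists (fstn k)|exists (sndn k)].
Qed.

Lemma semidec_or (S T : A -> Prop) :
  semidecidable S -> semidecidable T -> semidecidable (fun a => S a \/ T a).
Proof.
move=> [f cf fS] [g cg gT]; exists (fun p => f p || g p); first by cfun_tac.
move=> a; rewrite fS gT; split=> [[[i fi]|[i gi]]|[i /orP[fi|gi]]].
- by exists i; rewrite fi.
- by exists i; rewrite gi orbT.
- by left; exists i.
- by right; exists i.
Qed.

(** A single stage number carries both a candidate code for [b] and a stage for [S a b]; candidates
    that fail [valid] are rejected, since the realizer means nothing on them. *)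
Lemma semidec_ex (S : A -> B -> Prop) :
  semidecidable (fun p : A * B => S p.1 p.2) -> semidecidable (fun a => exists b, S a b).
Proof.
move=> [f [F cF fF] fS].
pose h (p : A * nat) := (valid (coded := cB) (fstn p.2)) &&
  (F (pairn (pairn (encode (coded := cA) p.1) (fstn p.2)) (sndn p.2)) != 0).
exists h.
  have cv : cfun (valid (coded := cB)) by apply/cfun_computable_bool/computable_valid.
  move/cfun_computable in cF.
  have ce : cfun (@encode A cA) by exists id => //; apply: computable_id.
  by rewrite /h; cfun_tac; apply: cfun_neg; apply: cfun_eq; cfun_tac.
move=> a; split=> [[b /(fS (a, b))[k fk]]|[k /andP[/validP[b bk] Fk]]].
  exists (pairn (encode b) k); rewrite /h !(fstn_pairn, sndn_pairn) /=.
  apply/andP; split; first by apply/validP; exists b.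
  by have := fF (a, b, k); rewrite fk => <-.
exists b; apply/(fS (a, b)); exists (sndn k).
by move: Fk; rewrite -bk -(fF (a, b, sndn k)) eqb0 negbK.
Qed.

(** Acceptance is made monotone in the stage, so that finitely many acceptances hold together at the
    largest of their stages. *)
Lemma semidec_stages (S : A -> Prop) : semidecidable S ->
  exists2 f : A * nat -> bool, cfun f &
    (forall a, S a <-> exists k, f (a, k)) /\
    (forall a i j, i <= j -> f (a, i) -> f (a, j)).
Proof.
move=> [f cf fS].
exists (fun p => has (fun i => f (p.1, i)) (iota 0 p.2.+1)).
  by apply: (cfun_has_iota (p := fun p i => f (p.1, i))); cfun_tac.
split=> [a|a i j ij /hasP[k]].
  rewrite fS; split=> [[k fk]|[k /hasP[i _ fi]]]; last by exists i.
  by exists k; apply/hasP; exists k => //; rewrite mem_iota ltnS leqnn.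
rewrite mem_iota => ki fk; apply/hasP; exists k => //; rewrite mem_iota.
by move: ki; rewrite /= !add0n !ltnS => /leq_trans; apply.
Qed.

End Semidecidable.

Lemma semidec_all_in {A : Type} {B : eqType} {cA : coded A} {cB : coded B}
    (S : A -> B -> Prop) (l : A -> seq B) :
  semidecidable (fun p : A * B => S p.1 p.2) -> cfun l ->
  semidecidable (fun a => forall b, b \in l a -> S a b).
Proof.
move=> /semidec_stages[f cf [fS fmon]] cl.
exists (fun p => all (fun b => f (p.1, b, p.2)) (l p.1)).
  by apply: (cfun_all (p := fun p b => f (p.1, b, p.2))); cfun_tac.
move=> a; elim: (l a) => [|b s IHs] /=; first by split=> // _; exists 0.
split=> [H|[k /andP[fk sk]] b']; last first.
  rewrite inE => /orP[/eqP ->|]; first by apply/(fS (a, b)); exists k.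
  by apply: IHs.2; exists k.
have [|k fk] := IHs.1; first by move=> b' sb'; apply: H; rewrite inE sb' orbT.
have /(fS (a, b))[j fj] := H b (mem_head _ _).
exists (maxn j k); rewrite (fmon _ _ _ _ fj) ?leq_maxl//=.
by apply: sub_all fk => b' ; apply: fmon; rewrite leq_maxr.
Qed.

Lemma semidec_all_ltn {A : Type} {cA : coded A} (S : A -> nat -> Prop) (k : A -> nat) :
  semidecidable (fun p : A * nat => S p.1 p.2) -> cfun k ->
  semidecidable (fun a => forall i, i < k a -> S a i).
Proof.
move=> sS ck; pose r (n : nat) := iteri n (fun i s => i :: s) [::].
have cr : cfun r.
  by apply: (cfun_iteri (g := fun _ i s => i :: s) (f := fun=> [::])); cfun_tac.
apply: (semidec_ext (S := fun a => forall i, i \in r (k a) -> S a i)); last first.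
  by apply: semidec_all_in => //; cfun_tac.
have rP n i : (i \in r n) = (i < n).
  by elim: n => // n IHn; rewrite /= inE IHn -leq_eqVlt ltnS.
by move=> a; split=> H i ik; apply: H; [rewrite rP|rewrite -rP].
Qed.

Lemma semidec_set1 {A : eqType} {cA : coded A} (x : A) : semidecidable [set x].
Proof.
apply: (semidec_ext (S := fun y => y == x)); first by move=> y; split=> /eqP.
by apply: semidec_bool; cfun_tac.
Qed.

(** This takes the place of a step-by-step machine model: by induction on the code, a computation is
    certified by finitely many intermediate values. *)
Lemma semidec_computes c : semidecidable (fun p : nat * nat => computes c p.1 p.2).
Proof.
have eqn_semidec (f g : nat * nat -> nat) : cfun f -> cfun g ->
    semidecidable (fun p => f p = g p).
  move=> cf cg; apply: semidec_ext (semidec_bool (cfun_eq cf cg)) => p.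
  by split=> /eqP.
have sub (A : Type) (cA : coded A) d (u v : A -> nat) :
    semidecidable (fun p : nat * nat => computes d p.1 p.2) ->
    cfun u -> cfun v -> semidecidable (fun a => computes d (u a) (v a)).
  move=> sd cu cv; apply: (semidec_comp (f := fun a => (u a, v a))) sd _.
  by cfun_tac.
elim: c => [||||f IHf g IHg|f IHf g IHg|f IHf g IHg|f IHf] /=.
- by apply: eqn_semidec; cfun_tac.
- by apply: eqn_semidec; cfun_tac.
- under eq_fun do rewrite fstnE.
  by apply: eqn_semidec; cfun_tac.
- under eq_fun do rewrite sndnE.
  by apply: eqn_semidec; cfun_tac.
- apply: (semidec_ext (S := fun p : nat * nat =>
    computes f p.1 (fstn p.2) /\ computes g p.1 (sndn p.2))).
    move=> [n m] /=; split=> [[fm gm]|[a [b [fa gb ->]]]].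
      by exists (fstn m), (sndn m); rewrite pairn_fstn_sndn.
    by rewrite fstn_pairn sndn_pairn.
  by apply: semidec_and; apply: sub => //; cfun_tac.
- apply: (semidec_ext (S := fun p : nat * nat =>
    exists k, computes g p.1 k /\ computes f k p.2)).
    by move=> p; split=> [[k []]|[k]]; exists k.
  by apply: semidec_ex; apply: semidec_and; apply: sub => //; cfun_tac.
(* Only the terms of the [Prec] sequence up to the recursion bound matter, so a finite list, which
   has a code, replaces the function [s]. *)
- apply: (semidec_ext (S := fun p : nat * nat =>
    exists l : seq nat, (computes f (fstn p.1) (nth 0 l 0) /\
      p.2 = nth 0 l (sndn p.1)) /\
      forall i, i < sndn p.1 ->
      computes g (pairn (fstn p.1) (pairn i (nth 0 l i))) (nth 0 l i.+1))).
    move=> [n m] /=; rewrite fstnE sndnE; split=> [[l [[fl ->] gl]]|[s [fs gs ->]]].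
      by exists (nth 0 l).
    exists (mkseq s (sndn n).+1); rewrite !nth_mkseq//; split=> // i lti.
    by rewrite !nth_mkseq ?ltnS//; [apply: gs|apply: ltnW].
  apply: semidec_ex; apply: semidec_and; first apply: semidec_and.
  + by apply: sub => //; [cfun_tac|apply: cfun_nth; cfun_tac].
  + apply: semidec_ext (semidec_bool (b := fun q : nat * nat * seq nat =>
       q.1.2 == nth 0 q.2 (sndn q.1.1)) _).
      by move=> q; split=> /eqP.
    by apply: cfun_eq; [cfun_tac|apply: cfun_nth; cfun_tac].
  + apply: (semidec_all_ltn (k := fun q : nat * nat * seq nat => sndn q.1.1)
      (S := fun q i => computes g (pairn (fstn q.1.1)
        (pairn i (nth 0 q.2 i))) (nth 0 q.2 i.+1))); last by cfun_tac.
    apply: sub => //; last by apply: cfun_nth; cfun_tac.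
    by cfun_tac; apply: cfun_nth; cfun_tac.
- apply: semidec_and; first by apply: sub => //; cfun_tac.
  apply: (semidec_all_ltn (S := fun p j => exists k, computes f (pairn p.1 j) k.+1));
    last by cfun_tac.
  by apply: semidec_ex; apply: sub => //; cfun_tac.
Qed.

(** From an enumeration, one searches for an input producing the code of [a]. Conversely, each pair
    of a code and an accepting stage is turned into an input whose output is that code. *)
Lemma semidec_enumerable {A : Type} {cA : coded A} (S : set A) :
  enumerable encode S <-> semidecidable S.
Proof.
split=> [[c cS]|[f [F cF fF] fS]].
  apply: (semidec_ext (S := fun a : A =>
    exists n, computes c n (encode a))).
    move=> a; rewrite cS; split=> [[b Sb e]|Sa]; last by exists a.
    by rewrite -(encode_inj e).
  apply: semidec_ex; apply: (semidec_comp (f := fun p : A * nat => (p.2, encode p.1)))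
    (semidec_computes c) _.
  by apply: cfun_pair; [cfun_tac|apply: cfun_encode; cfun_tac].
(* On input <m, k> the search [Mu h] halts iff stage [k] accepts the code [m]. *)
pose H n := if valid (coded := cA) (fstn (fstn n)) && (F (fstn n) != 0) then 0 else 1.
have [h hH] : computable H.
  apply/cfun_computable; rewrite /H.
  have cv : cfun (valid (coded := cA)) by apply/cfun_computable_bool/computable_valid.
  move/cfun_computable in cF.
  by apply: cfun_if; cfun_tac.
(* The number found by [Mu h] is discarded: [H] does not depend on the searched variable, so the
   search stops at 0 or never, and it acts as a filter on the input. *)
exists (Comp Left (Pair Left (Mu h))) => m; split.
  move=> [n [k]]; rewrite /= fstnE.
  move=> [a [b [-> [hb _] ->]]] ->; rewrite !fstnE fstn_pairn.
  have := computes_functional hb (hH _); rewrite /H fstn_pairn.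
  case: ifP => // /andP[/validP[x xn] Fn] _; exists x => //.
  apply/fS; exists (sndn n).
  have := fF (x, sndn n); rewrite /= /enc_prod /= xn.
  rewrite pairn_fstn_sndn => e; move: Fn; by rewrite -e; case: (f _).
move=> [x /fS[k fk] <-]; exists (pairn (encode x) k), (pairn (encode x) 0); last first.
  by rewrite /= fstnE fstn_pairn.
exists (encode x), 0; split=> //; first by rewrite /= fstnE fstn_pairn.
split=> //; have := hH (pairn (pairn (encode (coded := cA) x) k) 0).
rewrite /H !fstn_pairn -(fF (x, k)) fk andbT ifT//.
by apply/validP; exists x.
Qed.

Local Open Scope ring_scope.

(** * Tests from null sequences of open sets *)

Section Cylinders.
Variable R : realType.
Implicit Types (S : set word) (P Q : measures R).

Definition wopen S : set Omega := \bigcup_(x in S) cylinder x.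

Lemma measurable_cylinder y : measurable (cylinder y : set Omega).
Proof. by apply: sub_sigma_algebra; exists y. Qed.

Lemma measurable_wopen S : measurable (wopen S).
Proof.
rewrite /wopen bigcup_mkcond; apply: countable_bigcupT_measurable.
  exact: countableP.
by move=> x; case: ifP => _; [exact: measurable_cylinder|exact: measurable0].
Qed.

(** The superlevel set at a real [r] is the countable union of those at the rationals above or equal
    to [r]. *)
Lemma measurable_fun_rat_superlevel (f : Omega -> \bar R) :
  (forall q : rat, measurable [set w | ((ratr q)%:E < f w)%E]) ->
  measurable_fun setT f.
Proof.
move=> mf; apply: (measurability _ (ErealGenOInfty.measurableE R)).
move=> _ [_ [r ->] <-]; rewrite setTI.
have -> : f @^-1` `]r%:E, +oo[%classic =
    \bigcup_(q : rat) (if r <= ratr q then [set w | ((ratr q)%:E < f w)%E] else set0).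
  apply/seteqP; split=> [w|w [q _]] /=.
    rewrite in_itv /= andbT => rf.
    have [q rq qf] : exists2 q : rat, r <= ratr q & ((ratr q)%:E < f w)%E.
      case: (f w) rf => [s| |]//=.
        rewrite lte_fin => /rat_in_itvoo[q]; rewrite in_itv /= => /andP[rq qs].
        by exists q; [exact: ltW|rewrite lte_fin].
      have /rat_in_itvoo[q] : r < r + 1 by rewrite ltrDl.
      rewrite in_itv /= => /andP[rq _] _.
      by exists q; [exact: ltW|rewrite ltry].
    by exists q => //; rewrite rq.
  case: ifP => // rq /= qf; rewrite in_itv /= andbT.
  by apply: le_lt_trans qf; rewrite lee_fin.
apply: bigcupT_measurable_rat => q; case: ifP => // _.
Qed.

Lemma markov_le1 P (f : Omega -> \bar R) (c : R) : measurable_fun setT f ->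
  (forall w, 0 <= f w)%E -> (\int[P]_w f w <= 1)%E -> 0 < c ->
  (P [set w | (c%:E < f w)%E] <= (c^-1)%:E)%E.
Proof.
move=> mf f0 f1 c0.
have := le_integral_abse P measurableT mf c0; rewrite setTI.
under [X in (_ <= X)%E -> _]eq_integral do rewrite gee0_abs//.
move=> /le_trans/(_ f1) cP1.
have mle : measurable [set w | (c%:E <= `|f w|)%E].
  rewrite (_ : mkset _ = [set w | (c%:E <= f w)%E]).
    by rewrite -[X in measurable X]setTI; exact: emeasurable_fun_c_infty.
  by apply/funext => w /=; rewrite gee0_abs.
have mlt : measurable [set w | (c%:E < f w)%E].
  by rewrite -[X in measurable X]setTI; exact: emeasurable_fun_o_infty.
apply: (@le_trans _ _ (P [set w | (c%:E <= `|f w|)%E])).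
  by apply: le_measure; rewrite ?inE// => w /= /ltW; rewrite gee0_abs.
rewrite -[(c^-1)%:E]mule1 lee_pdivlMl//.
Qed.

(* Level [n] is given the weight [n.+1], so that the superlevel sets of the supremum
   are unions of levels and need no intersection. *)
Definition sup_level (D : set nat) : \bar R :=
  ereal_sup [set x | x = 0%E \/ exists2 n, D n & x = (n.+1%:R)%:E].

Lemma sup_level_ge0 D : (0 <= sup_level D)%E.
Proof. by apply: ereal_sup_ubound; left. Qed.

Lemma sup_levelT D : (forall n, D n) -> sup_level D = +oo%E.
Proof.
move=> DT; apply/eqyP => A A0; apply: ereal_sup_ge.
exists ((Num.truncn A).+1%:R)%:E; first by right; exists (Num.truncn A).
by rewrite lee_fin ltW// truncnS_gt.
Qed.

Lemma sup_level_gt D (r : R) :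
  (r%:E < sup_level D)%E <-> r < 0 \/ exists2 n, D n & r < n.+1%:R.
Proof.
split=> [/ereal_sup_gtP[x [->|[n Dn ->]]]|[r0|[n Dn rn]]].
- by rewrite lte_fin; left.
- by rewrite lte_fin; right; exists n.
- by apply: lt_le_trans (sup_level_ge0 D); rewrite lte_fin.
- by apply/ereal_sup_gtP; exists (n.+1%:R)%:E; [right; exists n|rewrite lte_fin].
Qed.

Section SupTest.
Variable V : nat -> set Omega.
Hypothesis mV : forall n, measurable (V n).

Lemma measurable_sup_level :
  measurable_fun setT (fun w => sup_level [set n | V n w]).
Proof.
apply: measurable_fun_rat_superlevel => q.
have [q0|q0] := boolP (ratr q < 0 :> R).
  rewrite (_ : mkset _ = setT); first exact: measurableT.
  by apply/funext => w /=; apply/propext; split=> // _; apply/sup_level_gt; left.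
rewrite (_ : mkset _ = \bigcup_(n in [set n | ratr q < n.+1%:R :> R]) V n).
  exact: bigcup_measurable.
apply/funext => w /=; apply/propext; rewrite sup_level_gt; split.
  by case=> [/(negP q0)//|[n Vn qn]]; exists n.
by move=> [n qn Vn]; right; exists n.
Qed.

(** The supremum is at most the sum of [n.+1] times the indicators of the [V n], and
    [n.+1 / 4 ^ n.+1] is at most [1 / 2 ^ n.+1]; these bounds sum to 1. *)
Lemma integral_sup_level_le1 P :
  (forall n, P (V n) <= (((4 ^ n.+1)%:R)^-1)%:E)%E ->
  (\int[P]_w sup_level [set n | V n w] <= 1)%E.
Proof.
move=> PV.
have mi n : measurable_fun setT (fun w : Omega => (n.+1%:R * \1_(V n) w)%:E : \bar R).
  by apply/measurable_EFinP/measurable_funM; [exact: measurable_cst|exact: measurable_indic].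
have i0 n (w : Omega) : (0 <= (n.+1%:R * \1_(V n) w)%:E :> \bar R)%E.
  by rewrite lee_fin mulr_ge0.
apply: (@le_trans _ _ (\int[P]_w \sum_(0 <= n <oo) (n.+1%:R * \1_(V n) w)%:E)%E).
  apply: ge0_le_integral => //.
  - by move=> w _; exact: sup_level_ge0.
  - exact: measurable_sup_level.
  - exact: ge0_emeasurable_sum.
  - move=> w _; apply: ge_ereal_sup => x [->|[n /= Vn ->]].
      by apply: nneseries_ge0 => n _ _.
    apply: (@le_trans _ _ ((n.+1%:R * \1_(V n) w)%:E)).
      by rewrite indicE mem_set// mulr1.
    rewrite (@nneseriesD1 _ _ n)//.
    by rewrite leeDl// nneseries_ge0.
rewrite integral_nneseries//.
apply: (@le_trans _ _ (\sum_(0 <= n <oo) (1 / (2 ^ (n + 1))%:R)%:E)%E).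
  apply: lee_nneseries => n _.
    by move=> _; apply: integral_ge0 => w _; exact: i0.
  under eq_integral do rewrite EFinM.
  rewrite ge0_integralZl_EFin//; last 1 first.
  - by apply/measurable_EFinP/measurable_indic.
  rewrite integral_indic// setIT.
  apply: (@le_trans _ _ ((n.+1%:R)%:E * (((4 ^ n.+1)%:R)^-1)%:E)%E).
    by apply: lee_wpmul2l; [rewrite lee_fin|exact: PV].
  rewrite -EFinM lee_fin addn1 ler_pdivrMr ?ltr0n ?expn_gt0//.
  rewrite (_ : 4 ^ n.+1 = 2 ^ n.+1 * 2 ^ n.+1)%N; last by rewrite -expnMn.
  rewrite natrM mulrA mul1r mulVf ?mul1r ?ler_nat ?pnatr_eq0 ?expn_eq0//.
  exact: ltnW (ltn_expl _ _).
have /cvg_lim -> // := @cvg_geometric_eseries_half R 1 0.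
by rewrite expr0 divr1.
Qed.

End SupTest.
End Cylinders.

(** * Prefixes, words of a given length, and the tests built from null sequences *)

Lemma cfun_mkseq_nth {A : Type} {cA : coded A} (x : A -> word) (i : A -> nat) :
  cfun x -> cfun i -> cfun (fun a => mkseq (nth false (x a)) (i a)).
Proof.
move=> cx ci.
(* Consing builds the prefix from its last letter, hence the reversed index. *)
apply: (cfun_ext (f := fun a => iteri (i a)
  (fun j s => nth false (x a) (i a - j.+1)%N :: s) [::])).
  move=> a; suff H k : (k <= i a)%N -> iteri k (fun j s =>
      nth false (x a) (i a - j.+1)%N :: s) [::] = map (nth false (x a)) (iota (i a - k) k).
    by rewrite H// subnn.
  by elim: k => // k IHk ki; rewrite [LHS]/= IHk ?[in RHS]/= ?subnSK// ltnW.
apply: (cfun_iteri (g := fun a j s => nth false (x a) (i a - j.+1)%N :: s)) => //;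
  cfun_tac.
by apply: cfun_nth; cfun_tac.
Qed.

Lemma cylinderP (x : word) (w : Omega) : cylinder x w <-> mkseq w (size x) = x.
Proof.
split=> [xw|e i ix]; last by rewrite -e nth_mkseq.
apply: (@eq_from_nth _ false); rewrite size_mkseq// => i ix.
by rewrite nth_mkseq// xw.
Qed.

Lemma cylinder_mkseq (w : Omega) k : cylinder (mkseq w k) w.
Proof. by apply/cylinderP; rewrite size_mkseq. Qed.

Lemma mkseq_nth_mkseq (w : nat -> bool) i k : (i <= k)%N ->
  mkseq (nth false (mkseq w k)) i = mkseq w i.
Proof.
move=> ik; apply/eq_in_map => j; rewrite mem_iota add0n => /= ji.
by rewrite nth_mkseq// (leq_trans ji).
Qed.

Definition words (k : nat) : seq word :=
  iteri k (fun _ l => foldl (fun acc y => (true :: y) :: (false :: y) :: acc) [::] l)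
    [:: [::]].

Lemma cfun_words {A : Type} {cA : coded A} (k : A -> nat) :
  cfun k -> cfun (fun a => words (k a)).
Proof.
move=> ck; apply: (cfun_iteri (g := fun _ _ l => foldl (fun acc y =>
  (true :: y) :: (false :: y) :: acc) [::] l)) => //; cfun_tac.
by apply: (cfun_foldl (f := fun _ acc y => (true :: y) :: (false :: y) :: acc));
  cfun_tac.
Qed.

Lemma mem_words (y : word) : y \in words (size y).
Proof.
elim: y => [|b y IHy] //=.
rewrite -/(words (size y)); elim/last_ind: (words _) IHy => // s z IHs.
rewrite mem_rcons inE foldl_rcons !inE => /orP[/eqP ->|/IHs ->].
  by case: (b); rewrite eqxx ?orbT.
by rewrite !orbT.
Qed.

Lemma size_words k (y : word) : y \in words k -> size y = k.
Proof.
elim: k y => [|k IHk] y /=; first by rewrite inE => /eqP ->.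
rewrite -/(words k); elim/last_ind: (words k) IHk => // s z IHs IHk.
rewrite foldl_rcons !inE => /or3P[/eqP ->|/eqP ->|].
- by rewrite /= IHk// mem_rcons mem_head.
- by rewrite /= IHk// mem_rcons mem_head.
- by apply: IHs => x xs; apply: IHk; rewrite mem_rcons inE xs orbT.
Qed.

Section Tests.
Variable R : realType.
Implicit Types P Q : measures R.

Lemma cfun_ltr_nat {A : Type} {cA : coded A} (q : A -> rat) (m : A -> nat) :
  cfun q -> cfun m -> cfun (fun a => q a < (m a)%:R).
Proof.
move=> cq cm; apply: (cfun_ext (f := fun a => q a * 1%:R < (m a)%:R)).
  by move=> a; rewrite mulr1.
exact: (cfun_ltr_rat (M := fun=> 0%N)) (cfun_const _).
Qed.

Lemma ltr_ratr_nat (q : rat) n : (ratr q < n%:R :> R) = (q < n%:R).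
Proof. by rewrite -(ltr_rat R) ratr_nat. Qed.

(** The supremum of the levels is a blind test for [P], and it is infinite at a point lying in all
    of them. *)
Lemma null_sequence_not_blindly_random P (E : set (nat * word)) : semidecidable E ->
  (forall n, P (wopen [set x | E (n, x)]) <= (((4 ^ n.+1)%:R)^-1)%:E)%E ->
  forall w, (forall n, wopen [set x | E (n, x)] w) -> ~ blindly_random P w.
Proof.
move=> sE PE w wE br.
pose t w := sup_level R [set n | wopen [set x | E (n, x)] w].
suff : blind_test P t by move=> /br; rewrite /t sup_levelT.
split; last 1 first.
- by apply: integral_sup_level_le1 => // n; exact: measurable_wopen.
(* Below 0 the superlevel set is the whole space, the cylinder of the empty word; from 0 on it is
   the union of the levels of weight above the threshold. *)
- pose E' (rx : rat * word) := (rx.1 < 0%:R /\ rx.2 = [::]) \/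
    exists n, rx.1 < n.+1%:R /\ E (n, rx.2).
  exists E'.
    apply: (semidec_enumerable E').2; apply: semidec_or.
      apply: (semidec_ext (S := fun rx : rat * word => (rx.1 < 0%:R) && (rx.2 == [::]))).
        by move=> rx; split=> [/andP[-> /eqP]|[-> ->]].
      apply: semidec_bool; apply: cfun_and; last by cfun_tac.
      by apply: (cfun_ltr_nat (m := fun=> 0%N)); cfun_tac.
    apply: semidec_ex; apply: semidec_and.
      by apply: semidec_bool; apply: (cfun_ltr_nat (m := fun p => p.2.+1)); cfun_tac.
    by apply: (semidec_comp (f := fun p : rat * word * nat => (p.2, p.1.2))) => //;
      cfun_tac.
  move=> r; apply/seteqP; split=> v.
    move=> /= /sup_level_gt; rewrite -[X in _ < X \/ _]/(0%:R) ltr_ratr_nat.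
    case=> [r0|[n [x Ex xv]]]; first by exists [::] => //; left.
    by rewrite ltr_ratr_nat => rn; exists x => //; right; exists n.
  move=> [x Ex xv] /=; apply/sup_level_gt; rewrite -[X in _ < X \/ _]/(0%:R).
  rewrite ltr_ratr_nat; case: Ex => [[? _]|[n [rn En]]]; [by left|right].
  by exists n; [exists x|rewrite ltr_ratr_nat].
- by move=> v; exact: sup_level_ge0.
Qed.

(** Since every level is small for all measures, the supremum is a uniform test; maximality of [t]
    then carries its infinite value over to [t]. *)
Lemma null_sequence_universal_test (t : Omega -> measures R -> \bar R)
    (E : set (nat * word * basic)) : universal_uniform_test t -> semidecidable E ->
  let V n Q := wopen [set x | exists b, E (n, x, b) /\ basic_set R b Q] in
  (forall n Q, Q (V n Q) <= (((4 ^ n.+1)%:R)^-1)%:E)%E ->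
  forall w Q, (forall n, V n Q w) -> t w Q = +oo%E.
Proof.
move=> [_ tuniv] sE V QV w Q wV.
pose t' w Q := sup_level R [set n | V n Q w].
suff /tuniv[c c0 /(_ w Q)] : uniform_test t'.
  rewrite /t' sup_levelT// leye_eq.
  by case: (t w Q) => //; rewrite gt0_muleNy ?lte_fin.
split; last 1 first.
- move=> Q'; apply: integral_sup_level_le1 => // n; exact: measurable_wopen.
- pose E' (rxb : rat * word * basic) := (rxb.1.1 < 0%:R /\ rxb.1.2 = [::] /\ rxb.2 = [::]) \/
    exists n, rxb.1.1 < n.+1%:R /\ E (n, rxb.1.2, rxb.2).
  exists E'.
    apply: (semidec_enumerable E').2; apply: semidec_or.
      apply: (semidec_ext (S := fun rxb : rat * word * basic =>
         (rxb.1.1 < 0%:R) && ((rxb.1.2 == [::]) && (rxb.2 == [::])))).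
        by move=> rx; split=> [/and3P[-> /eqP ? /eqP]|[-> [-> ->]]].
      apply: semidec_bool; apply: cfun_and; last by cfun_tac.
      by apply: (cfun_ltr_nat (m := fun=> 0%N)); cfun_tac.
    apply: semidec_ex; apply: semidec_and.
      by apply: semidec_bool; apply: (cfun_ltr_nat (m := fun p => p.2.+1)); cfun_tac.
    apply: (semidec_comp (f := fun p : rat * word * basic * nat =>
      (p.2, p.1.1.2, p.1.2))) => //; cfun_tac.
  move=> r; apply/seteqP; split=> -[v Q'].
    move=> /= /sup_level_gt; rewrite -[X in _ < X \/ _]/(0%:R) ltr_ratr_nat.
    case=> [r0|[n [x [b [Eb bQ]] xv]]].
      by exists ([::], [::]); [left|split].
    by rewrite ltr_ratr_nat => rn; exists (x, b) => //; right; exists n.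
  move=> [[x b] Ex [xv bQ]] /=; apply/sup_level_gt; rewrite -[X in _ < X \/ _]/(0%:R).
  rewrite ltr_ratr_nat; case: Ex => [[? _]|[n [rn En]]]; [by left|right].
  by exists n; [exists x => //; exists b|rewrite ltr_ratr_nat].
- by move=> v Q'; exact: sup_level_ge0.
Qed.

End Tests.

(** * Certificates of small measure *)

Section Certificates.
Variable R : realType.
Implicit Types (P Q : measures R) (b : basic) (a : seq (word * nat)).
Variable g : nat * nat * word -> bool.
Hypothesis cg : cfun g.

(** Membership depends on the first [k] bits only, so a stage is clopen and its measure is a finite
    sum over cylinders. *)
Definition stage n k : set Omega := [set w | g (n, k, mkseq w k)].

Lemma stageE n k : stage n k = wopen [set x | size x = k /\ g (n, k, x)].
Proof.
apply/seteqP; split=> [w gw|w [x [sx gx] /cylinderP xw]].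
  by exists (mkseq w k); [split=> //; rewrite size_mkseq|exact: cylinder_mkseq].
by rewrite /stage /= -sx xw sx.
Qed.

Lemma measurable_stage n k : measurable (stage n k).
Proof. by rewrite stageE; exact: measurable_wopen. Qed.

Definition bounds b (M : nat) (y : word) (m : nat) : bool :=
  has (fun c => (c.1.1 == y) && (c.2 * M.+1%:R < m%:R)) b.

(* [a] lists words [y] with an integer [m] such that the conditions in [b] force
   [Q (cylinder y) < m / M.+1]; these words cover [stage n k]. *)
Definition certb n k b a (M : nat) : bool :=
  all (fun y => g (n, k, y) ==>
    has (fun ym => (ym.1 == y) && bounds b M y ym.2) a) (words k)
  && (sumn [seq ym.2 | ym <- a] * 4 ^ n.+1 <= M.+1)%N.

Definition cert n k b : Prop := exists a M, certb n k b a M.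

Lemma semidec_cert {A : Type} {cA : coded A} (n k : A -> nat) (b : A -> basic) :
  cfun n -> cfun k -> cfun b -> semidecidable (fun x => cert (n x) (k x) (b x)).
Proof.
move=> cn ck cb; apply: semidec_ex; apply: semidec_ex; apply: semidec_bool.
apply: cfun_and.
  apply: (cfun_all (p := fun (q : A * seq (word * nat) * nat) y =>
    g (n q.1.1, k q.1.1, y) ==> has (fun ym => (ym.1 == y) &&
      bounds (b q.1.1) q.2 y ym.2) q.1.2)); last by apply: cfun_words; cfun_tac.
  apply: cfun_implb; first by cfun_tac.
  apply: (cfun_has (p := fun (q : A * seq (word * nat) * nat * word) ym =>
    (ym.1 == q.2) && bounds (b q.1.1.1) q.1.2 q.2 ym.2)); last by cfun_tac.
  apply: cfun_and; first by cfun_tac.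
  apply: (cfun_has (p := fun (q : A * seq (word * nat) * nat * word * (word * nat)) c =>
    (c.1.1 == q.1.2) && (c.2 * q.1.1.2.+1%:R < q.2.2%:R))); last by cfun_tac.
  apply: cfun_and; first by cfun_tac.
  by apply: (cfun_ltr_rat (M := fun q => q.1.1.1.2) (m := fun q => q.1.2.2)); cfun_tac.
apply: cfun_leq; last by cfun_tac.
apply: cfun_muln; last by cfun_tac.
apply: (cfun_ext (f := fun q : A * seq (word * nat) * nat =>
  foldl (fun s ym => s + ym.2)%N 0%N q.1.2)).
  move=> q; elim/last_ind: q.1.2 => // s x.
  by rewrite foldl_rcons map_rcons sumn_rcons => ->.
by apply: (cfun_foldl (f := fun _ s ym => s + ym.2)%N); cfun_tac.
Qed.

Lemma bounds_le b M y m Q : bounds b M y m -> basic_set R b Q ->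
  (Q (cylinder y) <= (m%:R / M.+1%:R)%:E)%E.
Proof.
move=> /hasP[[[z u] v] bc /= /andP[/eqP zy vm]] bQ; rewrite {}zy in bc.
have [_ Qv] := bQ _ _ _ bc; apply: le_trans (ltW Qv) _.
rewrite lee_fin ler_pdivlMr ?ltr0n//.
by move: vm; rewrite -(ltr_rat R) rmorphM /= !ratr_nat => /ltW.
Qed.

(** Subadditivity over the listed words: the bounds forced by [b] add up to at most [4 ^ -(n+1)],
    and the corresponding cylinders cover the stage. *)
Lemma cert_sound n k b Q : cert n k b -> basic_set R b Q ->
  (Q (stage n k) <= (((4 ^ n.+1)%:R)^-1)%:E)%E.
Proof.
move=> [a [M /andP[/allP ga suma]]] bQ.
pose W a := wopen [set x | has (fun ym => (ym.1 == x) && bounds b M x ym.2) a].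
have Wle a' : (Q (W a') <= ((sumn [seq ym.2 | ym <- a'])%:R / M.+1%:R)%:E)%E.
  elim: a' => [|[y m] a' IHa] /=.
    by rewrite (_ : W _ = set0) ?measure0 ?mul0r//; apply/seteqP; split=> // w [].
  pose U : set Omega := if bounds b M y m then cylinder y else set0.
  have WU : W ((y, m) :: a') `<=` U `|` W a'.
    rewrite /U => w [x /= /orP[/andP[/eqP <- ->]|xa] xw]; first by left.
    by right; exists x.
  have mU : measurable U.
    by rewrite /U; case: ifP => _; [exact: measurable_cylinder|exact: measurable0].
  apply: (@le_trans _ _ (Q (U `|` W a'))).
    by apply: le_measure WU; rewrite inE; [exact: measurable_wopen
      |apply: measurableU => //; exact: measurable_wopen].
  apply: le_trans (measureU2 _ mU (measurable_wopen _)) _.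
  rewrite natrD mulrDl EFinD leeD//.
  rewrite /U; case: ifPn => [bd|_]; first exact: bounds_le bQ.
  by rewrite measure0 lee_fin divr_ge0.
apply: (@le_trans _ _ (Q (W a))).
  apply: le_measure; rewrite ?inE; [exact: measurable_stage|exact: measurable_wopen|].
  rewrite stageE => w [x [sx gx] xw]; exists x => //=.
  have := ga x; rewrite -sx mem_words => /(_ isT) /implyP; apply.
  by rewrite sx.
apply: le_trans (Wle a) _; rewrite lee_fin ler_pdivrMr ?ltr0n//.
rewrite mulrC ler_pdivlMr ?ltr0n ?expn_gt0//.
by rewrite -natrM ler_nat.
Qed.

(** The strict inequality leaves room to round the measures of the finitely many cylinders up to
    fractions with a large common denominator. *)
Lemma cert_complete n k Q : (Q (stage n k) < (((4 ^ n.+1)%:R)^-1)%:E)%E ->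
  exists b, cert n k b /\ basic_set R b Q.
Proof.
(* Distinct words of the same length have disjoint cylinders, so the measure of the stage is exactly
   the sum over [s]. *)
pose s := undup [seq y <- words k | g (n, k, y) && (size y == k)].
pose p y := fine (Q (cylinder y)).
have pE y : Q (cylinder y) = (p y)%:E.
  by rewrite /p fineK//; apply: fin_num_measure; exact: measurable_cylinder.
have p0 y : 0 <= p y by rewrite -lee_fin -pE.
have -> : Q (stage n k) = (\sum_(y <- s) p y)%:E.
  have -> : stage n k = \bigcup_(y in [set` s]) (cylinder y : set Omega).
    rewrite stageE; congr (bigcup _ _); apply/seteqP; split=> y /=.
      by move=> [sy gy]; rewrite mem_undup mem_filter gy -sy eqxx mem_words.
    by rewrite mem_undup mem_filter => /andP[/andP[-> /eqP ->]].
  rewrite content_fin_bigcup//.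
  - rewrite -fsbig_seq ?undup_uniq//= -sumEFin; apply: eq_bigr => y _.
    by rewrite -pE.
  - exact: finite_seq.
  - move=> y z /=; rewrite !mem_undup !mem_filter.
    move=> /andP[/andP[_ /eqP sy] _] /andP[/andP[_ /eqP sz] _] [w [/cylinderP yw /cylinderP zw]].
    by rewrite -yw -zw sy sz.
  - by move=> y _; exact: measurable_cylinder.
  - exact: measurable_wopen.
rewrite lte_fin; set q0 := \sum_(y <- s) p y; set eps := (_^-1) => qe.
(* Rounding costs at most [2 / M.+1] for each word; this choice keeps the total within the gap
   [eps - q0]. *)
pose M := Num.truncn (2 * (size s)%:R / (eps - q0)).
have Mgt : 2 * (size s)%:R <= (eps - q0) * M.+1%:R.
  by rewrite [leRHS]mulrC -ler_pdivrMr ?subr_gt0//; apply: ltW; exact: truncnS_gt.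
(* The strict upper bound is [(c y).+1 / M.+1]; as [bounds] is strict too, the certificate lists
   [(c y).+2]. The lower bound -1 holds for every measure. *)
pose c y := Num.truncn (p y * M.+1%:R).
pose v y : rat := (c y).+1%:R / M.+1%:R.
pose b : basic := [seq (y, -1, v y) | y <- s].
exists b; split; last first.
  move=> y u' v' /mapP[z _ [-> -> ->]]; rewrite pE !lte_fin; split.
    by rewrite rmorphN rmorph1 (lt_le_trans _ (p0 z)).
  rewrite /v rmorphM fmorphV /= !ratr_nat ltr_pdivlMr ?ltr0n//.
  exact: truncnS_gt.
exists [seq (y, (c y).+2) | y <- s], M; apply/andP; split.
  apply/allP => y yk; apply/implyP => gy.
  have ys : y \in s by rewrite mem_undup mem_filter gy (size_words yk) eqxx.
  apply/hasP; exists (y, (c y).+2); first by apply/mapP; exists y.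
  rewrite /= eqxx; apply/hasP; exists (y, -1, v y); first by apply/mapP; exists y.
  by rewrite /= eqxx /v divfK ?pnatr_eq0// ltr_nat ltnSn.
rewrite -(ler_nat R) natrM -ler_pdivlMr ?ltr0n ?expn_gt0//.
rewrite -map_comp sumnE big_map natr_sum /=.
apply: (@le_trans _ _ (\sum_(y <- s) (p y * M.+1%:R + 2))).
  apply: ler_sum => y _; rewrite -addn2 natrD lerD2r.
  by rewrite truncn_le mulr_ge0.
rewrite big_split /= -mulr_suml -/q0 big_const_seq count_predT iter_addr_0.
rewrite -[2 *+ _]mulr_natr -/eps; move: Mgt; rewrite mulrBl [eps * _]mulrC; lra.
Qed.

End Certificates.

(** Stage [k] contains the sequences with a prefix of length at most [k] that is accepted by time
    [k]; the stages exhaust the open set increasingly. *)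
Lemma semidec_stage (E : set (nat * word)) : semidecidable E ->
  exists2 g : nat * nat * word -> bool, cfun g &
    (forall n i j, (i <= j)%N -> stage g n i `<=` stage g n j) /\
    (forall n, wopen [set x | E (n, x)] = \bigcup_k stage g n k).
Proof.
move=> /semidec_stages[f cf [fE fmon]].
pose g (q : nat * nat * word) :=
  has (fun i => f (q.1.1, mkseq (nth false q.2) i, q.1.2)) (iota 0 q.1.2.+1).
have gP n k w : stage g n k w <-> exists2 i, (i <= k)%N & f (n, mkseq w i, k).
  split=> [/hasP[i]|[i ik fi]].
    rewrite mem_iota add0n ltnS => /= ik.
    by rewrite mkseq_nth_mkseq//; exists i.
  apply/hasP; exists i; first by rewrite mem_iota add0n ltnS.
  by rewrite mkseq_nth_mkseq.
exists g.
  apply: (cfun_has_iota (p := fun q i => f (q.1.1, mkseq (nth false q.2) i, q.1.2)));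
    cfun_tac.
  by apply: cfun_mkseq_nth; cfun_tac.
split=> [n i j ij w /gP[l li fl]|n].
  by apply/gP; exists l; [exact: leq_trans ij|exact: fmon fl].
apply/seteqP; split=> [w [x /fE[k fk] /cylinderP xw]|w [k _ /gP[i ik fi]]].
  exists (maxn (size x) k) => //; apply/gP; exists (size x); first exact: leq_maxl.
  by rewrite xw; apply: fmon fk; exact: leq_maxr.
exists (mkseq w i); last exact: cylinder_mkseq.
by apply/fE; exists k.
Qed.

(** The certified indices [K] may have gaps. Still, the union over those up to [j] is empty or
    contained in a single [T k] with [k] in [K], and continuity from below gives the bound in the
    limit. *)
Lemma measure_bigcup_homo_le (R : realType) (P : measures R) (T : nat -> set Omega)
    (K : set nat) (e : \bar R) : (0 <= e)%E -> (forall k, measurable (T k)) ->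
  (forall i j, (i <= j)%N -> T i `<=` T j) -> (forall k, K k -> (P (T k) <= e)%E) ->
  (P (\bigcup_(k in K) T k) <= e)%E.
Proof.
move=> e0 mT homoT PT.
pose F j := \bigcup_(k in [set k | K k /\ (k <= j)%N]) T k.
have mF j : measurable (F j) by apply: bigcup_measurable.
have -> : \bigcup_(k in K) T k = \bigcup_j F j.
  apply/seteqP; split=> [w [k Kk Tk]|w [j _ [k [Kk _] Tk]]]; last by exists k.
  by exists k => //; exists k.
have Fle j : (P (F j) <= e)%E.
  have [F0|[k [Kk Fk]]] : F j = set0 \/ exists k, K k /\ F j `<=` T k.
  - elim: j => [|j IHj].
      have [K0|nK0] := pselect (K 0%N).
        right; exists 0%N; split=> // w [k [_ ]].
        by rewrite leqn0 => /eqP ->.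
      by left; apply/seteqP; split=> // w [k [Kk]]; rewrite leqn0 => /eqP k0; rewrite k0 in Kk.
    have [Kj|nKj] := pselect (K j.+1).
      right; exists j.+1; split=> // w [k [_ kj] Tk].
      exact: homoT Tk.
    have FS : F j.+1 = F j.
      apply/seteqP; split=> w [k [Kk kj] Tk]; exists k => //; split=> //.
        rewrite -ltnS ltn_neqAle kj andbT; apply: contra_notN nKj => /eqP <-//.
      exact: leqW.
    by rewrite FS.
  - by rewrite F0 measure0.
  - apply: le_trans (PT _ Kk); apply: le_measure; rewrite ?inE//.
have cvgF : (P \o F) x @[x --> \oo] --> P (\bigcup_j F j).
  apply: nondecreasing_cvg_mu => //; first exact: bigcupT_measurable.
  move=> i j ij; apply/subsetPset => w [k [Kk ki] Tk].
  by exists k => //; split=> //; exact: leq_trans ij.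
rewrite -(cvg_lim _ cvgF)//; apply: lime_le; last exact: nearW.
exact: cvgP cvgF.
Qed.

Section Measurability.
Variables (R : realType).
Implicit Types P Q : measures R.

Lemma lower_semicomputable_measurable (t : Omega -> \bar R) :
  lower_semicomputable t -> measurable_fun setT t.
Proof.
move=> [E _ tE]; apply: measurable_fun_rat_superlevel => q.
by rewrite tE; exact: measurable_wopen.
Qed.

Lemma lower_semicomputable2_measurable (t : Omega -> measures R -> \bar R) Q :
  lower_semicomputable2 t -> measurable_fun setT (fun w => t w Q).
Proof.
move=> [E _ tE]; apply: measurable_fun_rat_superlevel => q.
rewrite (_ : mkset _ = wopen [set x | exists b, E (q, x, b) /\ basic_set R b Q]).
  exact: measurable_wopen.
apply/seteqP; split=> w.
  move=> qw; have : [set wQ | ((ratr q)%:E < t wQ.1 wQ.2)%E] (w, Q) by [].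
  by rewrite tE => -[[x b] /= Eb [xw bQ]]; exists x => //; exists b.
move=> [x [b [Eb bQ]] xw].
suff : [set wQ | ((ratr q)%:E < t wQ.1 wQ.2)%E] (w, Q) by [].
by rewrite tE; exists (x, b).
Qed.

End Measurability.

(** * Uniform randomness implies blind randomness *)

Lemma uniformly_random_blindly_random (R : realType)
    (t : Omega -> measures R -> \bar R) (P : measures R) (w : Omega) :
  universal_uniform_test t -> uniformly_random t P w -> blindly_random P w.
Proof.
move=> tuniv wP t0 [t0lsc t0ge0 t0int].
have mt0 := lower_semicomputable_measurable t0lsc.
have [E0 eE0 t0E] := t0lsc.
apply/negP => /negP; rewrite -leNgt leye_eq => /eqP t0w.
(* The exponent [n.+2] makes Markov's bound strictly smaller than [4 ^ -(n+1)], as [cert_complete]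
   requires. *)
pose E1 (nx : nat * word) := E0 ((4 ^ nx.1.+2)%:R, nx.2).
have sE1 : semidecidable E1.
  apply: (semidec_comp (f := fun nx : nat * word => ((4 ^ nx.1.+2)%:R : rat, nx.2))).
    exact: (semidec_enumerable E0).1.
  by apply: cfun_pair; [apply: cfun_natr; cfun_tac|cfun_tac].
have [g cg [gmon gE]] := semidec_stage sE1.
have E1E n : wopen [set x | E1 (n, x)] = [set v | (((4 ^ n.+2)%:R : R)%:E < t0 v)%E].
  by have := t0E (4 ^ n.+2)%:R; rewrite ratr_nat => ->.
(* The trimming: a word of stage [k] is kept for the measures in [b] only if [b] certifies that this
   stage is small. *)
pose E2 (q : nat * word * basic) := exists k : nat,
  ((size q.1.2 == k) && g (q.1.1, k, q.1.2)) /\ cert g q.1.1 k q.2.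
have sE2 : semidecidable E2.
  apply: semidec_ex; apply: semidec_and; last by apply: semidec_cert; cfun_tac.
  apply: semidec_bool; apply: cfun_and; last by cfun_tac.
  by apply: cfun_eq; [apply: cfun_size|]; cfun_tac.
have VE n (Q : measures R) : wopen [set x | exists b, E2 (n, x, b) /\ basic_set R b Q] =
    \bigcup_(k in [set k | exists b, cert g n k b /\ basic_set R b Q]) stage g n k.
  apply/seteqP; split=> v.
    move=> [x [b [[k [/= /andP[/eqP sx gx] cb]] bQ]] xv].
    by exists k; [exists b|rewrite stageE; exists x].
  move=> [k [b [cb bQ]]]; rewrite stageE => -[x [sx gx] xv].
  by exists x => //; exists b; split=> //; exists k; rewrite /= sx eqxx.
have : t w P = +oo%E; last by move=> twP; move: wP; rewrite /uniformly_random twP.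
apply: (null_sequence_universal_test tuniv sE2) => [n Q|n]; rewrite VE.
  apply: measure_bigcup_homo_le => //.
  - by move=> k; exact: measurable_stage.
  - by move=> i j; exact: gmon.
  - by move=> k [b [cb bQ]]; exact: cert_sound bQ.
have : wopen [set x | E1 (n, x)] w by rewrite E1E /= t0w ltry.
(* Trimming loses nothing at [P]: all its stages are small, hence certified by some basic set
   containing [P]. *)
rewrite gE => -[k _ wk]; exists k => //.
apply: cert_complete => //; apply: (@le_lt_trans _ _ (((4 ^ n.+2)%:R)^-1)%:E).
  apply: (@le_trans _ _ (P (wopen [set x | E1 (n, x)]))).
    apply: le_measure; rewrite ?inE; [exact: measurable_stage|exact: measurable_wopen|].
    by rewrite gE; exact: bigcup_sup.
  by rewrite E1E; apply: markov_le1 => //; rewrite ltr0n expn_gt0.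
by rewrite lte_fin ltf_pV2 ?posrE ?ltr0n ?expn_gt0// ltr_nat ltn_exp2l.
Qed.

(** * Effectively compact classes *)

Section EffectivelyCompact.
Variable R : realType.
Implicit Types (P Q : measures R) (b : basic) (C : set (measures R)).

Lemma open_basic_set b : open (basic_set R b).
Proof.
exists [set basic_set R b]; first by move=> _ ->; exists b.
by rewrite bigcup_set1.
Qed.

Lemma compact_basic_cover C (D : set basic) : compact C ->
  C `<=` \bigcup_(b in D) basic_set R b ->
  exists2 s : seq basic, (forall b, b \in s -> D b) &
    C `<=` \bigcup_(b in [set` s]) basic_set R b.
Proof.
rewrite compact_cover => cC CD.
have [s sD Cs] := cC basic D (basic_set R) (fun b _ => open_basic_set b) CD.
exists (finmap.enum_fset s) => [b bs|Q /Cs[b bs bQ]]; last by exists b.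
by have := sD b bs; rewrite inE.
Qed.

Definition covers C (s : seq basic) : Prop :=
  C `<=` \bigcup_(b in [set` s]) basic_set R b.

Lemma semidec_covers C : effectively_compact C -> semidecidable (covers C).
Proof. by move=> [_ eC]; exact: (semidec_enumerable (covers C)).1 eC. Qed.

(** Removing open sets from a compact class leaves a compact one, whose covers become covers of [C]
    once the removed sets are added. *)
Definition excluding C (B : set basic) : set (measures R) :=
  [set Q | C Q /\ forall b, B b -> ~ basic_set R b Q].

(** By compactness, [t w Q] exceeds [r] on the whole remaining class iff finitely many basic sets
    cover [C], each of them in [B] or enumerated together with a prefix of [w]. Such covers can be
    searched for effectively. *)
Lemma semidec_above (t : Omega -> measures R -> \bar R) C (B : set basic) :
  lower_semicomputable2 t -> effectively_compact C -> semidecidable B ->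
  exists2 E : set (rat * word), semidecidable E & forall r,
    wopen [set x | E (r, x)] =
      [set w | forall Q, excluding C B Q -> ((ratr r)%:E < t w Q)%E].
Proof.
move=> [E eE tE] Ceff sB; have [compC _] := Ceff.
have sE : semidecidable E by apply: (semidec_enumerable E).1.
have tP r w Q : ((ratr r)%:E < t w Q)%E <->
    exists x b, [/\ E (r, x, b), cylinder x w & basic_set R b Q].
  have -> : ((ratr r)%:E < t w Q)%E =
     [set wQ | ((ratr r)%:E < t wQ.1 wQ.2)%E] (w, Q) :> Prop by [].
  rewrite tE; split=> [[[x b] Eb [xw bQ]]|[x [b [Eb xw bQ]]]]; last by exists (x, b).
  by exists x, b.
(* All prefixes are tried, so that one word can serve members of the cover whose witnessing prefixes
   differ in length. *)
pose hit (rx : rat * word) b := exists i, (i <= size rx.2)%N /\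
  E (rx.1, mkseq (nth false rx.2) i, b).
exists (fun rx => exists s, covers C s /\ forall b, b \in s -> B b \/ hit rx b).
  apply: semidec_ex; apply: semidec_and.
    by apply: (semidec_comp (f := snd)) (semidec_covers Ceff) _; cfun_tac.
  apply: (semidec_all_in (l := fun p : rat * word * seq basic => p.2)
    (S := fun p b => B b \/ hit p.1 b)); last by cfun_tac.
  apply: semidec_or.
    by apply: (semidec_comp (f := snd)) sB _; cfun_tac.
  apply: semidec_ex; apply: semidec_and.
    by apply: semidec_bool; apply: cfun_leq; [|apply: cfun_size]; cfun_tac.
  apply: (semidec_comp (f := fun p : rat * word * seq basic * basic * nat =>
    (p.1.1.1.1, mkseq (nth false p.1.1.1.2) p.2, p.1.2)) sE).
  by cfun_tac; apply: cfun_mkseq_nth; cfun_tac.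
move=> r; apply/seteqP; split=> w.
  move=> [x [s [Cs sH]] xw] Q [CQ nBQ].
  have [b bs bQ] := Cs _ CQ.
  have [/nBQ//|[i [/= ix Eb]]] := sH _ bs.
  apply/tP; exists (mkseq w i), b; split=> //; last exact: cylinder_mkseq.
  by move/cylinderP: xw Eb => <-; rewrite mkseq_nth_mkseq.
move=> /= Hw.
pose D b := B b \/ exists i, E (r, mkseq w i, b).
have [|s sD Cs] := @compact_basic_cover C D compC.
  move=> Q CQ; have [[b [Bb bQ]]|nB] := pselect (exists b, B b /\ basic_set R b Q).
    by exists b => //; left.
  have /tP[x [b [Eb /cylinderP xw bQ]]] : ((ratr r)%:E < t w Q)%E.
    by apply: Hw; split=> // b Bb bQ; apply: nB; exists b.
  by exists b => //; right; exists (size x); rewrite xw.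
have [N sN] : exists N, forall b, b \in s ->
    B b \/ exists i, (i <= N)%N /\ E (r, mkseq w i, b).
  elim: s sD {Cs} => [|b s IHs] sD; first by exists 0%N.
  have [|N sN] := IHs; first by move=> b' b's; apply: sD; rewrite inE b's orbT.
  have bs b' : b' \in b :: s -> b' = b \/ b' \in s.
    by rewrite inE => /orP[/eqP|]; [left|right].
  have [Bb|[i Eb]] := sD b (mem_head _ _).
    by exists N => b' /bs[->|/sN]//; left.
  exists (maxn i N) => b' /bs[->|/sN[|[j [jN Ej]]]]; [|by left|].
    by right; exists i; rewrite leq_maxl.
  by right; exists j; split=> //; rewrite leq_max jN orbT.
exists (mkseq w N); last exact: cylinder_mkseq.
exists s; split=> // b /sN[|[i [iN Ei]]]; first by left.
by right; exists i; rewrite /= size_mkseq mkseq_nth_mkseq.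
Qed.

Lemma probability_stage_lt (P : measures R) (T : nat -> set Omega) (e : R) : 0 < e ->
  (forall k, measurable (T k)) -> (forall i j, (i <= j)%N -> T i `<=` T j) ->
  P (\bigcup_k T k) = 1%E -> exists k, (P (~` T k) < e%:E)%E.
Proof.
move=> e0 mT Tmon PT.
have mbT : measurable (\bigcup_k T k) by exact: bigcupT_measurable.
have cv : (P \o (fun k => ~` T k)) x @[x --> \oo] --> P (\bigcap_k ~` T k).
  apply: nonincreasing_cvg_mu => //.
  - by apply: le_lt_trans (ltry 1); apply: probability_le1; exact: measurableC.
  - by move=> k; exact: measurableC.
  - by apply: bigcapT_measurable => k; exact: measurableC.
  - by move=> i j ij; apply/subsetPset; apply: subsetC; exact: Tmon.
rewrite -setC_bigcup probability_setC// PT subee// in cv.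
have : \forall k \near \oo, ((P \o (fun k => ~` T k)) k < e%:E)%E.
  have : nbhs (0 : \bar R)%E [set x | (x < e%:E)%E].
    by apply: open_nbhs_nbhs; split; [exact: open_ereal_lt_ereal|rewrite /= lte_fin].
  by move=> /cv.
by move=> [k _ /(_ k (leqnn k)) kP]; exists k.
Qed.

(* The set of the [w] all of whose tests [t w Q], [Q] outside [b0], exceed [r] is
   effectively open and has full measure for every [P] outside [b1].  By effective
   compactness its measure is approximated uniformly in [P], so that its complement
   is covered by a blind null sequence. *)
Lemma blindly_random_above (t : Omega -> measures R -> \bar R) C (b0 b1 : basic)
    (r : rat) P w :
  lower_semicomputable2 t -> effectively_compact C ->
  (forall Q, excluding C [set b1] Q ->
     Q [set v | forall Q', excluding C [set b0] Q' -> ((ratr r)%:E < t v Q')%E] = 1%E) ->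
  excluding C [set b1] P -> blindly_random P w ->
  forall Q, excluding C [set b0] Q -> ((ratr r)%:E < t w Q)%E.
Proof.
move=> tlsc Ceff full PC1 brP.
have [E sE EE] := semidec_above tlsc Ceff (semidec_set1 b0).
pose E1 (nx : nat * word) := E (r, nx.2).
have sE1 : semidecidable E1.
  by apply: (semidec_comp (f := fun nx : nat * word => (r, nx.2)) sE); cfun_tac.
have [g cg [gmon gE]] := semidec_stage sE1.
(* The stages of [h] are the complements of the [T k], whatever [n] is; [n] only fixes the accuracy
   demanded by [cert h n]. *)
pose h (q : nat * nat * word) := ~~ g (0%N, q.1.2, q.2).
have ch : cfun h by rewrite /h; cfun_tac.
pose T k := stage g 0 k.
have hT n k : stage h n k = ~` T k.
  by apply/seteqP; split=> v; rewrite /stage /h /T /=; move=> /negP.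
have bigT : \bigcup_k T k =
    [set v | forall Q', excluding C [set b0] Q' -> ((ratr r)%:E < t v Q')%E].
  by rewrite -(gE 0%N) -EE.
apply: contrapT => nw.
have wT k : ~ T k w.
  by move=> Tw; apply: nw; have : (\bigcup_k T k) w by [exists k]; rewrite bigT.
pose good n N b := b = b1 \/ exists N' : nat, (N' <= N)%N /\ cert h n N' b.
pose E3 (nx : nat * word) := exists N : nat,
  ((size nx.2 == N) && h (nx.1, N, nx.2)) /\
  exists s, covers C s /\ forall b, b \in s -> good nx.1 N b.
have sE3 : semidecidable E3.
  apply: semidec_ex; apply: semidec_and.
    apply: semidec_bool; apply: cfun_and; last by cfun_tac.
    by apply: cfun_eq; [apply: cfun_size|]; cfun_tac.
  apply: semidec_ex; apply: semidec_and.
    by apply: (semidec_comp (f := snd)) (semidec_covers Ceff) _; cfun_tac.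
  apply: (semidec_all_in (l := fun p : nat * word * nat * seq basic => p.2)
    (S := fun p b => good p.1.1.1 p.1.2 b)); last by cfun_tac.
  apply: semidec_or.
    by apply: (semidec_comp (f := snd)) (semidec_set1 b1) _; cfun_tac.
  apply: semidec_ex; apply: semidec_and.
    by apply: semidec_bool; apply: cfun_leq; cfun_tac.
  by apply: semidec_cert; cfun_tac.
pose K n : set nat := [set N | exists s, covers C s /\ forall b, b \in s -> good n N b].
have VE n : wopen [set x | E3 (n, x)] = \bigcup_(N in K n) ~` T N.
  apply/seteqP; split=> v.
    move=> [x [N [/= /andP[/eqP sx hx] [s [Cs sg]]]] xv].
    by exists N; [exists s|rewrite -(hT n) stageE; exists x].
  move=> [N [s [Cs sg]]]; rewrite -(hT n) stageE => -[x [sx hx] xv].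
  by exists x => //; exists N; rewrite /= sx eqxx; split=> //; exists s.
have Tanti i j : (i <= j)%N -> ~` T j `<=` ~` T i.
  by move=> ij; apply: subsetC; exact: gmon.
have mT k : measurable (~` T k) by apply: measurableC; exact: measurable_stage.
apply: (null_sequence_not_blindly_random sE3 _ _ brP) => n; rewrite VE.
  have [[N0 KN0]|noK] := pselect (exists N, K n N); last first.
    rewrite (_ : \bigcup_(N in _) _ = set0) ?measure0//.
    by apply/seteqP; split=> // v [N KN _]; apply: noK; exists N.
  (* The complements decrease, so the least [N] in [K n] controls the union; the member of its cover
     containing [P] is not [b1], hence it certifies an index at most [N]. *)
  have : exists N, `[< K n N >] by exists N0; apply/asboolP.
  case/ex_minnP => N /asboolP[s [Cs sg]] Nmin; have [PC Pb1] := PC1.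
  have [b bs bP] := Cs _ PC.
  case: (sg _ bs) => [bb1|[N' [N'N cb]]]; first by case: (Pb1 _ bb1 bP).
  apply: le_trans (cert_sound cb bP); rewrite hT.
  apply: le_measure; rewrite ?inE//; first exact: bigcup_measurable.
  move=> v [M KM]; apply: Tanti; apply: leq_trans N'N _.
  by apply: Nmin; apply/asboolP.
(* Level [n] contains [w]: every measure of [C] lies in [b1] or gives full measure to the union of
   the [T k], hence has a certified complement; a finite subcover then yields a common [N]. *)
have [||s sD Cs] := @compact_basic_cover C (fun b => exists N, good n N b).
- by case: Ceff.
- move=> Q CQ; have [b1Q|nb1Q] := pselect (basic_set R b1 Q).
    by exists b1 => //; exists 0%N; left.
  have [||||N QN] := @probability_stage_lt Q T ((4 ^ n.+1)%:R^-1).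
  + by rewrite invr_gt0 ltr0n expn_gt0.
  + by move=> k; exact: measurable_stage.
  + exact: gmon.
  + by rewrite bigT; apply: full; split=> // b ->.
  have [|b [cb bQ]] := @cert_complete R h n N Q; first by rewrite hT.
  by exists b => //; exists N; right; exists N.
have [N sN] : exists N, forall b, b \in s -> good n N b.
  elim: s sD {Cs} => [|b s IHs] sD; first by exists 0%N.
  have [|N sN] := IHs; first by move=> b' b's; apply: sD; rewrite inE b's orbT.
  have [M bM] := sD b (mem_head _ _).
  exists (maxn M N) => b'; rewrite inE => /orP[/eqP ->|/sN].
    by case: bM => [->|[N' [N'M c']]]; [left|right; exists N'; rewrite leq_max N'M].
  by case=> [->|[N' [N'M c']]]; [left|right; exists N'; rewrite leq_max N'M orbT].
by exists N; [exists s|exact: wT].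
Qed.

End EffectivelyCompact.

(** * Separation of measures, and the equivalence of the two notions *)

Lemma basic_set_eq (R : realType) (P Q : measures R) (b : basic) :
  (forall y, P (cylinder y) = Q (cylinder y)) -> basic_set R b P -> basic_set R b Q.
Proof. by move=> PQ bP y u v yuv; rewrite -PQ; exact: bP. Qed.

(** With rationals [u < v] strictly between the two values at [y], the conditions of being below [v]
    and above [u] overlap and so exhaust all measures. *)
Lemma basic_set_separation (R : realType) (P Q : measures R) (y : word) :
  (P (cylinder y) < Q (cylinder y))%E -> exists b0 b1,
  [/\ ~ basic_set R b1 P, ~ basic_set R b0 Q &
    forall Q' : measures R, basic_set R b0 Q' \/ basic_set R b1 Q'].
Proof.
have pE (Q' : measures R) : Q' (cylinder y) = (fine (Q' (cylinder y)))%:E.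
  by rewrite fineK//; apply: fin_num_measure; exact: measurable_cylinder.
have p0 (Q' : measures R) : (0 <= Q' (cylinder y))%E by [].
have p1 (Q' : measures R) : (Q' (cylinder y) <= 1)%E.
  by apply: probability_le1; exact: measurable_cylinder.
have sing (y' : word) (u' v' u v : rat) : ((y', u', v') \in [:: (y, u, v)]) ->
    [/\ y' = y, u' = u & v' = v].
  by rewrite inE => /eqP[-> -> ->].
rewrite (pE P) (pE Q) lte_fin => /rat_in_itvoo[v]; rewrite in_itv /= => /andP[Pv vQ].
have /rat_in_itvoo[u] := Pv; rewrite in_itv /= => /andP[Pu uv].
(* The bounds -1 and 2 hold for every probability and make the conditions one-sided. *)
exists [:: (y, -1, v)], [:: (y, u, 2%:R)]; split.
- move=> /(_ y u 2%:R); rewrite inE eqxx => /(_ isT)[+ _].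
  by rewrite pE lte_fin ltNge ltW.
- move=> /(_ y (-1) v); rewrite inE eqxx => /(_ isT)[_ +].
  by rewrite pE lte_fin ltNge ltW.
- move=> Q'; have [Qv|vQ'] := ltP (Q' (cylinder y)) (ratr v)%:E; [left|right].
    move=> _ _ _ /sing[-> -> ->]; split=> //; apply: lt_le_trans (p0 Q').
    by rewrite lte_fin rmorphN rmorph1.
  move=> _ _ _ /sing[-> -> ->]; split; first by apply: lt_le_trans vQ'; rewrite lte_fin.
  by apply: le_lt_trans (p1 Q') _; rewrite lte_fin ratr_nat ltr1n.
Qed.

(** Outside [A] the test is infinite, so Markov's inequality at level [1 / e] bounds that part by
    every positive [e]. *)
Lemma probability_finite_test (R : realType) (Q : measures R) (f : Omega -> \bar R)
    (A : set Omega) : measurable_fun setT f -> (forall w, 0 <= f w)%E ->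
  (\int[Q]_w f w <= 1)%E -> measurable A -> [set w | (f w < +oo)%E] `<=` A ->
  Q A = 1%E.
Proof.
move=> mf f0 f1 mA fA.
have mC : measurable (~` A) by exact: measurableC.
suff QC0 : Q (~` A) = 0%E by rewrite -[A]setCK probability_setC// QC0 sube0.
apply/eqP; rewrite eq_le measure_ge0 andbT; apply/lee_addgt0Pr => e e0.
rewrite add0e -[e]invrK; apply: le_trans (markov_le1 mf f0 f1 _) => //; last first.
  by rewrite invr_gt0.
apply: le_measure; rewrite ?inE//.
  by rewrite -[X in measurable X]setTI; exact: emeasurable_fun_o_infty.
move=> w /= nAw; have : ~ (f w < +oo)%E by move=> /fA.
by move=> /negP; rewrite -leNgt leye_eq => /eqP ->; rewrite ltry.
Qed.

Lemma blindly_random_uniformly_random (R : realType)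
    (t : Omega -> measures R -> \bar R) (C : set (measures R)) (P : measures R)
    (w : Omega) : uniform_test t -> effectively_compact C ->
  effectively_orthogonal t C -> C P -> blindly_random P w -> uniformly_random t P w.
Proof.
move=> [tlsc t0 t1] Ceff Corth CP brP.
have mt Q := lower_semicomputable2_measurable Q tlsc.
rewrite /uniformly_random; apply/negP => /negP; rewrite -leNgt leye_eq => /eqP twP.
have s0 : semidecidable (set0 : set basic).
  apply: (semidec_ext (S := fun=> false)); first by move=> b; split.
  by apply: semidec_bool; cfun_tac.
(* Otherwise [w] lies, for every [n], in the set where [t] exceeds [4 ^ n.+1] on all of [C]. As [P]
   is in [C], Markov's inequality makes these sets a null sequence for [P]. *)
have [r [Q [CQ ntQ]]] : exists (r : rat) Q, C Q /\ ~ ((ratr r)%:E < t w Q)%E.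
  have [E sE EE] := semidec_above tlsc Ceff s0.
  pose E1 (nx : nat * word) := E ((4 ^ nx.1.+1)%:R, nx.2).
  have sE1 : semidecidable E1.
    apply: (semidec_comp (f := fun nx : nat * word => ((4 ^ nx.1.+1)%:R : rat, nx.2)) sE).
    by apply: cfun_pair; [apply: cfun_natr; cfun_tac|cfun_tac].
  have E1E n := EE (4 ^ n.+1)%:R.
  apply: contrapT => noQ.
  apply: (null_sequence_not_blindly_random sE1 _ _ brP) => n.
    apply: le_trans (markov_le1 (mt P) (t0^~ P) (t1 P) _); last first.
      by rewrite ltr0n expn_gt0.
    apply: le_measure; rewrite ?inE; first exact: measurable_wopen.
      by rewrite -[X in measurable X]setTI; exact: emeasurable_fun_o_infty.
    rewrite /E1 /= E1E => v /= /(_ P); rewrite ratr_nat; apply.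
    by split.
  rewrite /E1 /= E1E => Q [CQ _].
  by apply: contrapT => nt; apply: noQ; exists (4 ^ n.+1)%:R, Q.
(* The superlevel sets of [t] see a measure only through basic sets, so agreement on cylinders would
   give [t w Q > r] from the infinite [t w P]. *)
have [y PQy] : exists y, P (cylinder y) <> Q (cylinder y).
  apply: contrapT => /forallNP PQ; apply: ntQ.
  have {}PQ y : P (cylinder y) = Q (cylinder y) by have /contrapT := PQ y.
  have [E _ tE] := tlsc.
  have : [set wQ | ((ratr r)%:E < t wQ.1 wQ.2)%E] (w, P) by rewrite /= twP ltry.
  rewrite tE => -[xb Exb [xw bP]].
  suff : [set wQ | ((ratr r)%:E < t wQ.1 wQ.2)%E] (w, Q) by [].
  by rewrite tE; exists xb => //; split=> //; exact: basic_set_eq bP.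
have [b0 [b1 [nP nQ b01]]] : exists b0 b1, [/\ ~ basic_set R b1 P, ~ basic_set R b0 Q &
    forall Q' : measures R, basic_set R b0 Q' \/ basic_set R b1 Q'].
  have [lt|lt|//] := ltgtP (P (cylinder y)) (Q (cylinder y)).
    exact: basic_set_separation lt.
  have [c0 [c1 [nc1 nc0 c01]]] := basic_set_separation lt.
  by exists c1, c0; split=> // Q'; case: (c01 Q'); [right|left].
apply: ntQ; apply: (@blindly_random_above R t C b0 b1 r P w) => //; last first.
- by split=> // b ->.
- by split=> // b ->.
move=> Q2 [CQ2 nQ2]; have {}nQ2 := nQ2 _ erefl.
apply: (probability_finite_test (mt Q2) (t0^~ Q2) (t1 Q2)).
  have [E _ <-] := semidec_above tlsc Ceff (semidec_set1 b0).
  exact: measurable_wopen.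
(* If [t v Q'] were at most [r], then [v] would be random for both [Q2] and [Q']. By orthogonality
   they agree on measurable sets; but [Q'], being outside [b0], lies in [b1], and [Q2] does not. *)
move=> v vQ2 Q' [CQ' nQ']; apply: contrapT => /negP; rewrite -leNgt => tv.
have vQ' : Randoms t Q' v by apply: le_lt_trans tv _; exact: ltry.
have : (Randoms t Q2 `&` Randoms t Q') v by [].
rewrite Corth//; apply: contrapT => same; apply: nQ2.
apply: (basic_set_eq (P := Q')); last by case: (b01 Q') => // /(nQ' _ erefl).
move=> z; apply: contrapT => ne; apply: same.
by exists (cylinder z); [exact: measurable_cylinder|move=> e; exact: ne].
Qed.

Theorem theorem21 (R : realType) (t : Omega -> measures R -> \bar R)
    (ht : universal_uniform_test t) (C : set (measures R))
    (hC : effectively_compact C) (hC' : effectively_orthogonal t C) :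
  forall P : measures R, C P -> forall w : Omega,
    uniformly_random t P w <-> blindly_random P w.
Proof.
move=> P CP w; split; first exact: uniformly_random_blindly_random.
by have [ut _] := ht; apply: (blindly_random_uniformly_random ut hC hC' CP).
Qed.
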